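(* Let $\mathbf{K}$ be an algebraically closed field, let $\mathcal{D}$ be a $\mathbf{K}$-linear idempotent complete triangulated category, and let $\Phi : \mathcal{D} \to \mathcal{D}$ be an exact endofunctor such that $\Phi^N \not\cong 0$ for every $N>0$. Let $t \in \mathbf{R}$. (1) Let $\mathfrak{a}$ be a bounded t-structure on $\mathcal{D}$ with finite heart. Then $h_t(\Phi) = \hat{h}_t^{\mathfrak{a}}(\Phi)$. (2) Let $\mathfrak{b}$ be a bounded co-t-structure on $\mathcal{D}$ with finite co-heart. Then $h_t(\Phi) = \check{h}_t^{\mathfrak{b}}(\Phi)$.
   Context: $\Sigma$ is the shift functor of $\mathcal{D}$. A filtration of $X\in\mathcal{D}$ with factors $X_1,\dots,X_m$ is a sequence $0=Y_0\to Y_1\to\cdots\to Y_m=X$ together with exact triangles $Y_{i-1}\to Y_i\to X_i\to\Sigma Y_{i-1}$ for $1\le i\le m$. Convention: $\log 0=-\infty$. Categorical entropy. An object $G$ is a split-generator of $\mathcal{D}$ if the smallest thick subcategory (triangulated subcategory closed under direct summands) containing $G$ is $\mathcal{D}$. For $E,F\in\mathcal{D}$, $t\in\mathbf{R}$, the categorical complexity $\delta_t(E,F)$ is $0$ if $F\cong 0$; otherwise it is the infimum of $\sum_{i=1}^m e^{k_it}$ over all filtrations of $F\oplus F'$ (for some $F'\in\mathcal{D}$) with factors $\Sigma^{k_1}E,\dots,\Sigma^{k_m}E$, $k_i\in\mathbf{Z}$ (so $\infty$ if there are none). The categorical entropy is $h_t(\Phi)=\lim_{N\to\infty}\frac1N\log\delta_t(G,\Phi^N(G))$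 for a split-generator $G$ of $\mathcal{D}$; the limit exists and is independent of $G$. When speaking of categorical entropy, $\mathcal{D}$ is assumed to have a split-generator. t-structures. A t-structure $\mathfrak{a}=(\mathcal{D}^{\le0},\mathcal{D}^{\ge0})$ is a pair of full (isomorphism-closed) additive subcategories such that, with $\mathcal{D}^{\ge1}:=\Sigma^{-1}\mathcal{D}^{\ge0}$: (i) $\Sigma\mathcal{D}^{\le0}\subset\mathcal{D}^{\le0}$, $\Sigma^{-1}\mathcal{D}^{\ge0}\subset\mathcal{D}^{\ge0}$; (ii) $\mathrm{Hom}(E,F)=0$ for $E\in\mathcal{D}^{\le0}$, $F\in\mathcal{D}^{\ge1}$; (iii) every $E$ fits in an exact triangle $D\to E\to F\to\Sigma D$ with $D\in\mathcal{D}^{\le0}$, $F\in\mathcal{D}^{\ge1}$. It is bounded if $\mathcal{D}=\bigcup_{k\in\mathbf{Z}}\Sigma^k\mathcal{D}^{\le0}=\bigcup_{k\in\mathbf{Z}}\Sigma^k\mathcal{D}^{\ge0}$. Its heart $\mathcal{H}_{\mathfrak{a}}=\mathcal{D}^{\le0}\cap\mathcal{D}^{\ge0}$ is abelian; it is finite if every object has a composition series and there are finitely many isomorphism classes of simple objects; $\lambda_{\mathcal{H}_{\mathfrak{a}}}(E)$ is then the length of $E\in\mathcal{H}_{\mathfrak{a}}$. For $\mathfrak{a}$ bounded, each $E\in\mathcal{D}$ has a t-filtration, i.e. a filtration with factors $\Sigma^{k_1}E_1,\dots,\Sigma^{k_m}E_m$, $E_i\in\mathcal{H}_{\mathfrak{a}}$,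 $k_1>\cdots>k_m$, essentially unique. Put $\hat\delta_t^{\mathfrak{a}}(E)=\sum_{i=1}^m\lambda_{\mathcal{H}_{\mathfrak{a}}}(E_i)e^{k_it}$ and $\hat h_t^{\mathfrak{a}}(\Phi)=\sup_{E\in\mathcal{D}}\limsup_{N\to\infty}\frac1N\log\hat\delta_t^{\mathfrak{a}}(\Phi^N(E))$. Co-t-structures. A co-t-structure $\mathfrak{b}=(\mathcal{D}_{\ge0},\mathcal{D}_{\le0})$ is a pair of full additive subcategories closed under direct summands such that, with $\mathcal{D}_{\ge1}:=\Sigma^{-1}\mathcal{D}_{\ge0}$: (i) $\Sigma^{-1}\mathcal{D}_{\ge0}\subset\mathcal{D}_{\ge0}$, $\Sigma\mathcal{D}_{\le0}\subset\mathcal{D}_{\le0}$; (ii) $\mathrm{Hom}(E,F)=0$ for $E\in\mathcal{D}_{\ge1}$, $F\in\mathcal{D}_{\le0}$; (iii) every $E$ fits in an exact triangle $D\to E\to F\to\Sigma D$ with $D\in\mathcal{D}_{\ge1}$, $F\in\mathcal{D}_{\le0}$. It is bounded if $\mathcal{D}=\bigcup_{k\in\mathbf{Z}}\Sigma^k\mathcal{D}_{\ge0}=\bigcup_{k\in\mathbf{Z}}\Sigma^k\mathcal{D}_{\le0}$. Its co-heart $\mathcal{C}_{\mathfrak{b}}=\mathcal{D}_{\ge0}\cap\mathcal{D}_{\le0}$ is finite if it is Krull–Schmidt (every object is a finite direct sum of objects with local endomorphism rings) with finitely many isomorphism classes of indecomposables; $\sigma_{\mathcal{C}_{\mathfrak{b}}}(E)$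 is then the number of indecomposable summands of $E\in\mathcal{C}_{\mathfrak{b}}$. For $\mathfrak{b}$ bounded, each $E\in\mathcal{D}$ has a (non-unique) co-t-filtration, i.e. a filtration with factors $\Sigma^{k_1}E_1,\dots,\Sigma^{k_m}E_m$, $E_i\in\mathcal{C}_{\mathfrak{b}}$, $k_1<\cdots<k_m$. Put $\check\delta_t^{\mathfrak{b}}(E)=\inf\sum_{i=1}^m\sigma_{\mathcal{C}_{\mathfrak{b}}}(E_i)e^{k_it}$ over all co-t-filtrations of $E$, and $\check h_t^{\mathfrak{b}}(\Phi)=\sup_{E\in\mathcal{D}}\limsup_{N\to\infty}\frac1N\log\check\delta_t^{\mathfrak{b}}(\Phi^N(E))$. *)

(* Defs.v *)
From mathcomp Require Import all_boot all_order all_algebra.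
From mathcomp Require Import all_classical all_reals all_analysis.
Set Implicit Arguments.
Unset Strict Implicit.
Unset Printing Implicit Defensive.
Import Order.TTheory GRing.Theory Num.Theory.
Local Open Scope classical_set_scope.
Local Open Scope ring_scope.

Record lincat (K : fieldType) := LinCat {
  Obj :> Type;
  Hom : Obj -> Obj -> lmodType K;
  idm : forall X, Hom X X;
  comp : forall X Y Z, Hom Y Z -> Hom X Y -> Hom X Z;
  comp1m : forall X Y (f : Hom X Y), comp (idm Y) f = f;
  compm1 : forall X Y (f : Hom X Y), comp f (idm X) = f;
  compA : forall X Y Z W (h : Hom Z W) (g : Hom Y Z) (f : Hom X Y),
    comp h (comp g f) = comp (comp h g) f;
  comp_linl : forall X Y Z (c : K) (g g' : Hom Y Z) (f : Hom X Y),
    comp (c *: g + g') f = c *: comp g f + comp g' f;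
  comp_linr : forall X Y Z (c : K) (g : Hom Y Z) (f f' : Hom X Y),
    comp g (c *: f + f') = c *: comp g f + comp g f' }.

Arguments Hom {K l} X Y.
Arguments idm {K l} X.
Arguments comp {K l X Y Z} g f.

Notation "g ∘ f" := (comp g f) (at level 40, left associativity).

Section Categories.
Variables (K : fieldType) (C : lincat K).
Implicit Types X Y Z : C.

Definition is_iso X Y (f : Hom X Y) : Prop :=
  exists g : Hom Y X, g ∘ f = idm X /\ f ∘ g = idm Y.

Definition isom X Y : Prop := exists f : Hom X Y, is_iso f.

Definition is_mono X Y (f : Hom X Y) : Prop :=
  forall Z (g h : Hom Z X), f ∘ g = f ∘ h -> g = h.

Definition is_coker X Y Z (f : Hom X Y) (g : Hom Y Z) : Prop :=
  g ∘ f = 0 /\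
  forall W (h : Hom Y W), h ∘ f = 0 -> exists! h' : Hom Z W, h' ∘ g = h.

Definition is_zero X : Prop :=
  forall Y, (forall f : Hom X Y, f = 0) /\ (forall f : Hom Y X, f = 0).

Definition is_biprod X Y B : Prop :=
  exists (i1 : Hom X B) (i2 : Hom Y B) (p1 : Hom B X) (p2 : Hom B Y),
    [/\ p1 ∘ i1 = idm X, p2 ∘ i2 = idm Y, p1 ∘ i2 = 0, p2 ∘ i1 = 0
      & i1 ∘ p1 + i2 ∘ p2 = idm B].

Definition is_dirsum n (X : 'I_n -> C) B : Prop :=
  exists (i : forall j, Hom (X j) B) (p : forall j, Hom B (X j)),
    [/\ forall j, p j ∘ i j = idm (X j),
        forall j k, j != k -> p j ∘ i k = 0
      & \sum_j (i j ∘ p j) = idm B].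

Definition is_additive : Prop :=
  (exists Z, is_zero Z) /\ (forall X Y, exists B, is_biprod X Y B).

Definition idempotent_complete : Prop :=
  forall X (e : Hom X X), e ∘ e = e ->
  exists Y (r : Hom X Y) (s : Hom Y X), r ∘ s = idm Y /\ s ∘ r = e.

(* The full subcategory on [P] is closed under isomorphism and additive. *)
Definition additive_subcat (P : C -> Prop) : Prop :=
  [/\ forall X Y, isom X Y -> P X -> P Y,
      forall X, is_zero X -> P X
    & forall X Y B, is_biprod X Y B -> P X -> P Y -> P B].

Definition closed_summands (P : C -> Prop) : Prop :=
  forall X Y B, is_biprod X Y B -> P B -> P X.

Definition full_sub (P : C -> Prop) : lincat K :=
  @LinCat K {X : C | P X} (fun a b => Hom (sval a) (sval b))
    (fun a => idm (sval a)) (fun a b c g f => g ∘ f)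
    (fun a b => @comp1m K C (sval a) (sval b))
    (fun a b => @compm1 K C (sval a) (sval b))
    (fun a b c d => @compA K C (sval a) (sval b) (sval c) (sval d))
    (fun a b c => @comp_linl K C (sval a) (sval b) (sval c))
    (fun a b c => @comp_linr K C (sval a) (sval b) (sval c)).

(* [simple], [comp_series] and [lambda] are used for abelian [C] only. *)
Definition simple X : Prop :=
  ~ is_zero X /\
  forall Y (f : Hom Y X), is_mono f -> is_zero Y \/ is_iso f.

(* [comp_series n X]: there is a chain 0 = X_0 >-> ... >-> X_n = X of
   monomorphisms, all of whose cokernels are simple. *)
Inductive comp_series : nat -> C -> Prop :=
| comp_series0 X : is_zero X -> comp_series 0 X
| comp_seriesS n Y X S (f : Hom Y X) (g : Hom X S) :
    comp_series n Y -> is_mono f -> is_coker f g -> simple S ->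
    comp_series n.+1 X.

Definition finite_length_cat : Prop :=
  (forall X, exists n, comp_series n X) /\
  (exists n (S : 'I_n -> C), forall X, simple X -> exists i, isom X (S i)).

(* Well defined on a finite length abelian category, by Jordan-Hoelder. *)
Definition lambda X : nat := xget 0%N [set n | comp_series n X].

Definition local_end X : Prop :=
  ~ is_zero X /\
  forall f g : Hom X X, ~ is_iso f -> ~ is_iso g -> ~ is_iso (f + g).

Definition indecomposable X : Prop :=
  ~ is_zero X /\ forall Y Z, is_biprod Y Z X -> is_zero Y \/ is_zero Z.

Definition krull_schmidt : Prop :=
  forall X, exists n (Y : 'I_n -> C),
    (forall i, local_end (Y i)) /\ is_dirsum Y X.

Definition finite_krull_schmidt : Prop :=
  krull_schmidt /\
  (exists n (S : 'I_n -> C),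
     forall X, indecomposable X -> exists i, isom X (S i)).

(* Well defined on a Krull-Schmidt category, by the theorem of that name. *)
Definition sigma X : nat :=
  xget 0%N [set n | exists Y : 'I_n -> C,
                      (forall i, indecomposable (Y i)) /\ is_dirsum Y X].

End Categories.

Record functor (K : fieldType) (C D : lincat K) := Functor {
  fobj :> C -> D;
  fmor : forall X Y, Hom X Y -> Hom (fobj X) (fobj Y);
  fmor1 : forall X, fmor (idm X) = idm (fobj X);
  fmorM : forall X Y Z (g : Hom Y Z) (f : Hom X Y),
    fmor (g ∘ f) = fmor g ∘ fmor f }.

Arguments fmor {K C D} _ {X Y} _.

Section Functors.
Variable K : fieldType.

Definition fid (C : lincat K) : functor C C :=
  @Functor K C C (fun X => X) (fun X Y f => f)
    (fun=> erefl) (fun _ _ _ _ _ => erefl).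

Lemma fcomp1 (C D E : lincat K) (G : functor D E) (F : functor C D) (X : C) :
  fmor G (fmor F (idm X)) = idm (G (F X)).
Proof. by rewrite !fmor1. Qed.

Lemma fcompM (C D E : lincat K) (G : functor D E) (F : functor C D)
    (X Y Z : C) (g : Hom Y Z) (f : Hom X Y) :
  fmor G (fmor F (g ∘ f)) = fmor G (fmor F g) ∘ fmor G (fmor F f).
Proof. by rewrite !fmorM. Qed.

Definition fcomp (C D E : lincat K) (G : functor D E) (F : functor C D) :
    functor C E :=
  @Functor K C E (fun X => G (F X)) (fun X Y f => fmor G (fmor F f))
    (fcomp1 G F) (@fcompM C D E G F).

Fixpoint fpow (C : lincat K) (F : functor C C) (n : nat) : functor C C :=
  if n is m.+1 then fcomp F (fpow F m) else fid C.

Lemma fzero1 (C : lincat K) (Z : C) : is_zero Z -> 0 = idm Z.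
Proof. by move=> Z0; have [h _] := Z0 Z; rewrite [RHS]h. Qed.

Lemma fzeroM (C : lincat K) (Z : C) : is_zero Z ->
  0 = (0 : Hom Z Z) ∘ (0 : Hom Z Z).
Proof. by move=> Z0; have [h _] := Z0 Z; rewrite [RHS]h. Qed.

Definition fzero (C D : lincat K) (Z : D) (Z0 : is_zero Z) : functor C D :=
  @Functor K C D (fun=> Z) (fun _ _ _ => 0)
    (fun=> fzero1 Z0) (fun _ _ _ _ _ => fzeroM Z0).

Definition nat_iso (C D : lincat K) (F G : functor C D)
    (eta : forall X, Hom (F X) (G X)) : Prop :=
  (forall X Y (f : Hom X Y), fmor G f ∘ eta X = eta Y ∘ fmor F f) /\
  (forall X, is_iso (eta X)).

Definition fisom (C D : lincat K) (F G : functor C D) : Prop :=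
  exists eta, @nat_iso C D F G eta.

Definition additive_functor (C D : lincat K) (F : functor C D) : Prop :=
  forall X Y (f g : Hom X Y), fmor F (f + g) = fmor F f + fmor F g.

Definition linear_functor (C D : lincat K) (F : functor C D) : Prop :=
  forall X Y (c : K) (f g : Hom X Y),
    fmor F (c *: f + g) = c *: fmor F f + fmor F g.

End Functors.

(* The shift is an auto-equivalence with a chosen quasi-inverse, so that a
   shift that is a strict automorphism is a special case.  The axioms on
   distinguished triangles are TR1 (dist_iso, dist_id, dist_cone), TR2
   (dist_rot), TR3 (dist_mor) and the octahedral axiom TR4 (dist_oct). *)
Record tricat (K : fieldType) := TriCat {
  tcat :> lincat K;
  tcat_additive : is_additive tcat;
  shift : functor tcat tcat;
  unshift : functor tcat tcat;
  shift_linear : linear_functor shift;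
  shiftK : fisom (fcomp unshift shift) (fid tcat);
  unshiftK : fisom (fcomp shift unshift) (fid tcat);
  dist : forall X Y Z : tcat,
    Hom X Y -> Hom Y Z -> Hom Z (shift X) -> Prop;
  dist_iso : forall (X Y Z X' Y' Z' : tcat)
      (f : Hom X Y) (g : Hom Y Z) (h : Hom Z (shift X))
      (f' : Hom X' Y') (g' : Hom Y' Z') (h' : Hom Z' (shift X'))
      (a : Hom X X') (b : Hom Y Y') (c : Hom Z Z'),
    is_iso a -> is_iso b -> is_iso c ->
    b ∘ f = f' ∘ a -> c ∘ g = g' ∘ b -> fmor shift a ∘ h = h' ∘ c ->
    dist f g h -> dist f' g' h';
  dist_id : forall X Z : tcat, is_zero Z ->
    dist (idm X) (0 : Hom X Z) (0 : Hom Z (shift X));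
  dist_cone : forall (X Y : tcat) (f : Hom X Y),
    exists Z (g : Hom Y Z) (h : Hom Z (shift X)), dist f g h;
  dist_rot : forall (X Y Z : tcat)
      (f : Hom X Y) (g : Hom Y Z) (h : Hom Z (shift X)),
    dist f g h <-> dist g h (- fmor shift f);
  dist_mor : forall (X Y Z X' Y' Z' : tcat)
      (f : Hom X Y) (g : Hom Y Z) (h : Hom Z (shift X))
      (f' : Hom X' Y') (g' : Hom Y' Z') (h' : Hom Z' (shift X'))
      (a : Hom X X') (b : Hom Y Y'),
    dist f g h -> dist f' g' h' -> b ∘ f = f' ∘ a ->
    exists c : Hom Z Z', c ∘ g = g' ∘ b /\ fmor shift a ∘ h = h' ∘ c;
  dist_oct : forall (X Y Z Z' X' Y' : tcat)
      (f : Hom X Y) (f1 : Hom Y Z') (f2 : Hom Z' (shift X))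
      (g : Hom Y Z) (g1 : Hom Z X') (g2 : Hom X' (shift Y))
      (h1 : Hom Z Y') (h2 : Hom Y' (shift X)),
    dist f f1 f2 -> dist g g1 g2 -> dist (g ∘ f) h1 h2 ->
    exists (u : Hom Z' Y') (v : Hom Y' X'),
      [/\ dist u v (fmor shift f1 ∘ g2),
          u ∘ f1 = h1 ∘ g, h2 ∘ u = f2, v ∘ h1 = g1
        & g2 ∘ v = fmor shift f ∘ h2] }.

Section Triangulated.
Variables (K : fieldType) (D : tricat K).
Implicit Types X Y Z E F G : D.

Definition shiftz (k : int) (X : D) : D :=
  match k with
  | Posz n => fpow (shift D) n X
  | Negz n => fpow (unshift D) n.+1 X
  end.

Definition shifted (k : int) (P : D -> Prop) (X : D) : Prop :=
  exists Y, P Y /\ isom X (shiftz k Y).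

Definition exact_functor (Phi : functor D D) : Prop :=
  additive_functor Phi /\
  exists eta : forall X, Hom (Phi (shift D X)) (shift D (Phi X)),
    @nat_iso _ _ _ (fcomp Phi (shift D)) (fcomp (shift D) Phi) eta /\
    forall X Y Z (f : Hom X Y) (g : Hom Y Z) (h : Hom Z (shift D X)),
      dist f g h -> dist (fmor Phi f) (fmor Phi g) (eta X ∘ fmor Phi h).

(* [filtration Xs X]: X has a filtration with list of factors Xs. *)
Inductive filtration : seq D -> D -> Prop :=
| filtration0 X : is_zero X -> filtration [::] X
| filtrationS Xs Y X Z (f : Hom Y X) (g : Hom X Z) (h : Hom Z (shift D Y)) :
    filtration Xs Y -> dist f g h -> filtration (rcons Xs Z) X.

Definition thick (P : D -> Prop) : Prop :=
  [/\ additive_subcat P,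
      forall X, P X <-> P (shift D X),
      forall X Y Z (f : Hom X Y) (g : Hom Y Z) (h : Hom Z (shift D X)),
        dist f g h -> P X -> P Y -> P Z
    & closed_summands P].

Definition split_generator G : Prop :=
  forall P : D -> Prop, thick P -> P G -> forall X, P X.

Record t_structure := TStructure {
  tle : D -> Prop;
  tge : D -> Prop;
  tle_additive : additive_subcat tle;
  tge_additive : additive_subcat tge;
  tle_shift : forall X, tle X -> tle (shift D X);
  tge_unshift : forall X, tge X -> tge (unshift D X);
  t_orth : forall E F, tle E -> shifted (-1) tge F ->
    forall f : Hom E F, f = 0;
  t_decomp : forall E, exists (A B : D)
      (f : Hom A E) (g : Hom E B) (h : Hom B (shift D A)),
    [/\ tle A, shifted (-1) tge B & dist f g h] }.

(* [shifted k P] is the essential image Sigma^k P, so that [shifted (-1) tge]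
   above is D^{>=1}; likewise [shifted (-1) cge] below is D_{>=1}. *)
Definition t_bounded (a : t_structure) : Prop :=
  forall X, (exists k, shifted k (tle a) X) /\ (exists k, shifted k (tge a) X).

Definition heart (a : t_structure) : lincat K :=
  full_sub (fun X => tle a X /\ tge a X).

Record cot_structure := CotStructure {
  cge : D -> Prop;
  cle : D -> Prop;
  cge_additive : additive_subcat cge;
  cle_additive : additive_subcat cle;
  cge_summands : closed_summands cge;
  cle_summands : closed_summands cle;
  cge_unshift : forall X, cge X -> cge (unshift D X);
  cle_shift : forall X, cle X -> cle (shift D X);
  cot_orth : forall E F, shifted (-1) cge E -> cle F ->
    forall f : Hom E F, f = 0;
  cot_decomp : forall E, exists (A B : D)
      (f : Hom A E) (g : Hom E B) (h : Hom B (shift D A)),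
    [/\ shifted (-1) cge A, cle B & dist f g h] }.

Definition cot_bounded (b : cot_structure) : Prop :=
  forall X, (exists k, shifted k (cge b) X) /\ (exists k, shifted k (cle b) X).

Definition coheart (b : cot_structure) : lincat K :=
  full_sub (fun X => cge b X /\ cle b X).

(* Factors Sigma^k E are recorded as pairs (k, E). *)
Definition t_filtration (a : t_structure) (E : D)
    (fs : seq (int * heart a)) : Prop :=
  filtration [seq shiftz p.1 (sval p.2) | p <- fs] E /\
  sorted >%R [seq p.1 | p <- fs].

Definition cot_filtration (b : cot_structure) (E : D)
    (fs : seq (int * coheart b)) : Prop :=
  filtration [seq shiftz p.1 (sval p.2) | p <- fs] E /\
  sorted <%R [seq p.1 | p <- fs].

Section Entropy.
Variable R : realType.
Implicit Types (t : R) (Phi : functor D D).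
Local Open Scope ereal_scope.

Definition delta t E F : \bar R :=
  if `[< is_zero F >] then 0 else
  ereal_inf [set s | exists (F' B : D) (ks : seq int),
    [/\ is_biprod F F' B, filtration [seq shiftz k E | k <- ks] B
      & s = (\sum_(k <- ks) expR (k%:~R * t))%R%:E]].

(* Independent of the chosen t-filtration, which is essentially unique. *)
Definition hat_delta (a : t_structure) t E : R :=
  xget 0%R [set s | exists fs : seq (int * heart a), t_filtration E fs /\
    s = (\sum_(p <- fs) (lambda p.2)%:R * expR (p.1%:~R * t))%R].

Definition check_delta (b : cot_structure) t E : \bar R :=
  ereal_inf [set s | exists fs : seq (int * coheart b), cot_filtration E fs /\
    s = (\sum_(p <- fs) (sigma p.2)%:R * expR (p.1%:~R * t))%R%:E].

(* The value at N = 0 is 0 and does not affect limits; lne 0 = -oo. *)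
Definition growth (u : nat -> \bar R) : nat -> \bar R :=
  fun N => (N%:R^-1)%R%:E * lne (u N).

Definition entropy_seq G Phi t : nat -> \bar R :=
  growth (fun N => delta t G (fpow Phi N G)).

(* h_t(Phi), computed with the split-generator G. *)
Definition cat_entropy G Phi t : \bar R := limn (entropy_seq G Phi t).

Definition hat_entropy (a : t_structure) Phi t : \bar R :=
  ereal_sup [set limn_esup (growth (fun N => (hat_delta a t (fpow Phi N E))%:E))
            | E in [set: D]].

Definition check_entropy (b : cot_structure) Phi t : \bar R :=
  ereal_sup [set limn_esup (growth (fun N => check_delta b t (fpow Phi N E)))
            | E in [set: D]].

End Entropy.
End Triangulated.

(* Main.v *)
(* A shift-weighted list of factors [k_1, ..., k_m] has weight
   [sum_i exp (k_i t)].  The idea is to compare, up to multiplicative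
   constants, [delta_t(G, F)] with the least weight of a list along which [F]
   is filtered by shifts of simple objects of the heart (resp. of
   indecomposable objects of the co-heart).  The constants do not affect growth
   rates, [N |-> delta_t(G, Phi^N G)] is submultiplicative, so that Fekete's
   lemma gives the limit, and
   [delta_t(G, Phi^N E) <= delta_t(G, Phi^N G) delta_t(G, E)] shows that the
   supremum over [E] is attained at [G].

   An arbitrary filtration by shifted simples can be bubble-sorted: two
   neighbours in the wrong order either split or, by Schur's lemma, cancel.  A
   Jordan-Hoelder exchange argument, carried out for triangles, shows that a
   sorted filtration of [F + F'] is the union of sorted filtrations of [F] and
   [F'], so passing to a summand does not increase the weight.

   For a co-t-structure, neighbours in the wrong order always split, but sorted
   filtrations are not unique.  Since the indecomposables have local
   endomorphism rings, a redundant pair of factors in degrees [k], [k - 1] can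
   be cancelled, and minimal sorted filtrations of [F] and [F'] embed in every
   sorted filtration of [F + F']. *)

From Pilot Require Import Defs.
From mathcomp Require Import all_boot all_order all_algebra.
From mathcomp Require Import all_classical all_reals all_analysis.
From mathcomp Require Import zify.
Set Implicit Arguments.
Unset Strict Implicit.
Unset Printing Implicit Defensive.
Import Order.TTheory GRing.Theory Num.Theory.
(* Re-imported because MathComp also declares [Hom], [comp], ... *)
Import Pilot.Defs.
Local Open Scope classical_set_scope.
Local Open Scope ring_scope.

(** * Linear categories and functors *)

(** A weight sees only degrees, so a filtration keeps just its list of integers; which simple or
    indecomposable object sits in a degree is forgotten, and the exchange arguments end in a
    [perm_eq] between integer lists. Finiteness of the number of isomorphism classes enters through
    the constant of [built_weight]. The two halves differ in the connecting map of neighbouring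
    factors. For a t-structure it can be an isomorphism when the labels differ by one, so sorting
    may shorten a list, but the sorted list is then determined by the object. For a co-t-structure
    it vanishes for neighbours in the wrong order, yet even the zero object has the sorted list k +
    1, k, from the triangle C -> 0 -> Sigma C. Hence filtrations of least length are used; such a
    list is contained, up to order, in every other one, so a single list attains the infimum for all
    t. The hypothesis on the powers of Phi keeps the complexity of Phi^N G positive, so that its
    logarithm is a real number and Fekete's lemma can be applied to a real subadditive sequence. *)

Section LinearCategory.
Variables (K : fieldType) (C : lincat K).
Implicit Types X Y Z W : C.

Lemma comp0l X Y Z (f : Hom X Y) : (0 : Hom Y Z) ∘ f = 0.
Proof.
have := comp_linl (-1) (0 : Hom Y Z) 0 f.
by rewrite scaler0 addr0 scaleN1r addNr.
Qed.

Lemma comp0r X Y Z (g : Hom Y Z) : g ∘ (0 : Hom X Y) = 0.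
Proof.
have := comp_linr (-1) g (0 : Hom X Y) 0.
by rewrite scaler0 addr0 scaleN1r addNr.
Qed.

Lemma compDl X Y Z (g g' : Hom Y Z) (f : Hom X Y) :
  (g + g') ∘ f = g ∘ f + g' ∘ f.
Proof. by have := comp_linl 1 g g' f; rewrite !scale1r. Qed.

Lemma compDr X Y Z (g : Hom Y Z) (f f' : Hom X Y) :
  g ∘ (f + f') = g ∘ f + g ∘ f'.
Proof. by have := comp_linr 1 g f f'; rewrite !scale1r. Qed.

Lemma compNl X Y Z (g : Hom Y Z) (f : Hom X Y) : (- g) ∘ f = - (g ∘ f).
Proof.
by have := comp_linl (-1) g 0 f; rewrite comp0l !addr0 !scaleN1r.
Qed.

Lemma compNr X Y Z (g : Hom Y Z) (f : Hom X Y) : g ∘ (- f) = - (g ∘ f).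
Proof.
by have := comp_linr (-1) g f 0; rewrite comp0r !addr0 !scaleN1r.
Qed.

Lemma compBl X Y Z (g g' : Hom Y Z) (f : Hom X Y) :
  (g - g') ∘ f = g ∘ f - g' ∘ f.
Proof. by rewrite compDl compNl. Qed.

Lemma compBr X Y Z (g : Hom Y Z) (f f' : Hom X Y) :
  g ∘ (f - f') = g ∘ f - g ∘ f'.
Proof. by rewrite compDr compNr. Qed.

Lemma comp_suml X Y Z n (g : 'I_n -> Hom Y Z) (f : Hom X Y) :
  (\sum_i g i) ∘ f = \sum_i (g i ∘ f).
Proof.
by apply: (big_morph (fun h => h ∘ f)) => [a b|]; rewrite ?compDl ?comp0l.
Qed.

Lemma comp_sumr X Y Z n (g : Hom Y Z) (f : 'I_n -> Hom X Y) :
  g ∘ (\sum_i f i) = \sum_i (g ∘ f i).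
Proof.
by apply: (big_morph (fun h => g ∘ h)) => [a b|]; rewrite ?compDr ?comp0r.
Qed.

Lemma is_iso_id X : is_iso (idm X).
Proof. by exists (idm X); rewrite comp1m. Qed.

Lemma is_iso_comp X Y Z (g : Hom Y Z) (f : Hom X Y) :
  is_iso g -> is_iso f -> is_iso (g ∘ f).
Proof.
move=> [g' [g'g gg']] [f' [f'f ff']]; exists (f' ∘ g'); split.
  by rewrite compA -(compA f') g'g compm1.
by rewrite compA -(compA g) ff' compm1.
Qed.

Lemma is_iso_opp X Y (f : Hom X Y) : is_iso f -> is_iso (- f).
Proof.
by move=> [g [gf fg]]; exists (- g); rewrite !compNl !compNr !opprK.
Qed.

Lemma is_iso_LR X Y (f : Hom X Y) (l r : Hom Y X) :
  l ∘ f = idm X -> f ∘ r = idm Y -> is_iso f.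
Proof.
move=> lf fr; exists r; split => //.
have -> : r = l by rewrite -[r]comp1m -lf -compA fr compm1.
by [].
Qed.

Lemma isom_refl X : isom X X.
Proof. by exists (idm X); apply: is_iso_id. Qed.

Lemma isom_sym X Y : isom X Y -> isom Y X.
Proof. by move=> [f [g [gf fg]]]; exists g, f. Qed.

Lemma isom_trans Y X Z : isom X Y -> isom Y Z -> isom X Z.
Proof. by move=> [f isof] [g isog]; exists (g ∘ f); apply: is_iso_comp. Qed.

Lemma is_zeroP X : is_zero X <-> idm X = 0.
Proof.
split=> [X0|id0 Y]; first by have [h _] := X0 X; apply: h.
by split=> f; [rewrite -[f]compm1 id0 comp0r|rewrite -[f]comp1m id0 comp0l].
Qed.

Lemma is_zero_isom X Y : isom X Y -> is_zero X -> is_zero Y.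
Proof.
move=> [f [g [gf fg]]] /is_zeroP X0; apply/is_zeroP.
by rewrite -fg -[f]compm1 X0 comp0r comp0l.
Qed.

Definition hom0 X Y := forall f : Hom X Y, f = 0.

Lemma hom0_id X : hom0 X X -> is_zero X.
Proof. by move=> h; apply/is_zeroP; apply: h. Qed.

Lemma hom0_zerol X Y : is_zero X -> hom0 X Y.
Proof. by move=> /(_ Y)[]. Qed.

Lemma hom0_zeror X Y : is_zero Y -> hom0 X Y.
Proof. by move=> /(_ X)[]. Qed.

Lemma hom0_isom X X' Y Y' : isom X X' -> isom Y Y' -> hom0 X Y -> hom0 X' Y'.
Proof.
move=> [a [a' [a'a aa']]] [b [b' [b'b bb']]] h f.
have -> : f = b ∘ (b' ∘ f ∘ a) ∘ a' by rewrite !compA bb' comp1m -compA aa' compm1.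
by rewrite (h (b' ∘ f ∘ a)) comp0r comp0l.
Qed.

Definition retract X B :=
  exists (i : Hom X B) (p : Hom B X), p ∘ i = idm X.

Lemma retract_refl X : retract X X.
Proof. by exists (idm X), (idm X); rewrite comp1m. Qed.

Lemma retract_trans Y X Z : retract X Y -> retract Y Z -> retract X Z.
Proof.
move=> [i [p pi]] [j [q qj]]; exists (j ∘ i), (p ∘ q).
by rewrite compA -(compA p) qj compm1.
Qed.

Lemma isom_retract X Y : isom X Y -> retract X Y.
Proof. by move=> [f [g [gf _]]]; exists f, g. Qed.

Lemma retract_zero X Y : retract X Y -> is_zero Y -> is_zero X.
Proof.
move=> [i [p pi]] /is_zeroP Y0; apply/is_zeroP.
by rewrite -pi -[p]compm1 Y0 comp0r comp0l.
Qed.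

Lemma biprod_sym X Y B : is_biprod X Y B -> is_biprod Y X B.
Proof.
move=> [i1 [i2 [p1 [p2 [e1 e2 e3 e4 e5]]]]].
by exists i2, i1, p2, p1; split=> //; rewrite addrC.
Qed.

Lemma biprod_retract X Y B : is_biprod X Y B -> retract X B.
Proof. by move=> [i1 [i2 [p1 [p2 [e1 _ _ _ _]]]]]; exists i1, p1. Qed.

Lemma comp_mid X Y Z W V (a : Hom W V) (b : Hom Z W) (c : Hom Y Z)
  (d : Hom X Y) : a ∘ b ∘ (c ∘ d) = a ∘ (b ∘ c) ∘ d.
Proof. by rewrite !compA. Qed.

Lemma biprod_uniq X Y B B' : is_biprod X Y B -> is_biprod X Y B' -> isom B B'.
Proof.
move=> [i1 [i2 [p1 [p2 [e1 e2 e3 e4 e5]]]]].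
move=> [j1 [j2 [q1 [q2 [f1 f2 f3 f4 f5]]]]].
exists (j1 ∘ p1 + j2 ∘ p2), (i1 ∘ q1 + i2 ∘ q2); split.
  rewrite !compDl !compDr !comp_mid f1 f2 f3 f4.
  by rewrite !compm1 !comp0r !comp0l addr0 add0r.
rewrite !compDl !compDr !comp_mid e1 e2 e3 e4.
by rewrite !compm1 !comp0r !comp0l addr0 add0r.
Qed.

Lemma biprod0 X Z : is_zero Z -> is_biprod X Z X.
Proof.
move=> Z0; exists (idm X), 0, (idm X), 0.
split; rewrite ?comp1m ?comp0l ?comp0r ?addr0 //.
by symmetry; apply/is_zeroP.
Qed.

Lemma biprod_zero_isom X Z B : is_biprod X Z B -> is_zero Z -> isom X B.
Proof. by move=> bB Z0; apply: biprod_uniq bB; apply: biprod0. Qed.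

End LinearCategory.

Section FunctorIso.
Variables (K : fieldType) (C E : lincat K) (F : functor C E).

Lemma fmor_iso X Y (f : Hom X Y) : is_iso f -> is_iso (fmor F f).
Proof.
by move=> [g [gf fg]]; exists (fmor F g); rewrite -!fmorM gf fg !fmor1.
Qed.

Lemma fobj_isom X Y : isom X Y -> isom (F X) (F Y).
Proof. by move=> [f /fmor_iso isof]; exists (fmor F f). Qed.

Lemma fobj_retract X Y : retract X Y -> retract (F X) (F Y).
Proof.
by move=> [i [p pi]]; exists (fmor F i), (fmor F p); rewrite -fmorM pi fmor1.
Qed.

Hypothesis Fadd : additive_functor F.

Lemma fmor0 X Y : fmor F (0 : Hom X Y) = 0.
Proof.
by apply: (addIr (fmor F (0 : Hom X Y))); rewrite -Fadd add0r add0r.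
Qed.

Lemma fmorN X Y (f : Hom X Y) : fmor F (- f) = - fmor F f.
Proof. by apply: (addIr (fmor F f)); rewrite -Fadd !addNr fmor0. Qed.

Lemma fobj_zero X : is_zero X -> is_zero (F X).
Proof. by move=> /is_zeroP X0; apply/is_zeroP; rewrite -fmor1 X0 fmor0. Qed.

End FunctorIso.

(** [shiftz] is made of two iterations, of [shift] and of [unshift]; a step that is an equivalence
    covers both signs at once. *)
Lemma int_updown (P : int -> Prop) : P 0 -> (forall k, P k <-> P (k + 1)) ->
  forall k, P k.
Proof.
move=> P0 PS; elim/int_ind => // n IH.
  by have /PS := IH; rewrite -addn1 PoszD.
by apply/PS; rewrite -addn1 PoszD opprD subrK.
Qed.

(** * Triangles *)

Section Shift.
Variables (K : fieldType) (D : tricat K).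
Implicit Types X Y Z W : D.

Lemma shift_additive : additive_functor (shift D).
Proof.
by move=> X Y f g; have := shift_linear 1 f g; rewrite !scale1r.
Qed.

Lemma shift0 X Y : fmor (shift D) (0 : Hom X Y) = 0.
Proof. exact: fmor0 shift_additive _ _. Qed.

Lemma shiftN X Y (f : Hom X Y) : fmor (shift D) (- f) = - fmor (shift D) f.
Proof. exact: fmorN shift_additive _ _ _. Qed.

Lemma isom_unshiftK X : isom (unshift D (shift D X)) X.
Proof. by have [eta [_ ise]] := shiftK D; exists (eta X); apply: ise. Qed.

Lemma isom_shiftK X : isom (shift D (unshift D X)) X.
Proof. by have [eta [_ ise]] := unshiftK D; exists (eta X); apply: ise. Qed.

Lemma iso_epi X Y Z (e : Hom X Y) (f g : Hom Y Z) :
  is_iso e -> f ∘ e = g ∘ e -> f = g.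
Proof.
move=> [e' [_ ee']] fg.
by rewrite -[f]compm1 -[g]compm1 -ee' !compA fg.
Qed.

Lemma shift_inj X Y (f g : Hom X Y) :
  fmor (shift D) f = fmor (shift D) g -> f = g.
Proof.
move=> fg; have [eta [nat ise]] := shiftK D.
by apply: (iso_epi (ise X)); rewrite [LHS]nat [RHS]nat /= fg.
Qed.

Lemma unshift_inj X Y (f g : Hom X Y) :
  fmor (unshift D) f = fmor (unshift D) g -> f = g.
Proof.
move=> fg; have [eta [nat ise]] := unshiftK D.
by apply: (iso_epi (ise X)); rewrite [LHS]nat [RHS]nat /= fg.
Qed.

(** The preimage is [unshift h] conjugated by the natural isomorphism; the identity is checked after
    applying [unshift], which is faithful. *)
Lemma shift_full X Y (h : Hom (shift D X) (shift D Y)) :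
  exists f : Hom X Y, fmor (shift D) f = h.
Proof.
have [eta [nat ise]] := shiftK D.
have [e' [e'e ee']] := ise X.
exists (eta Y ∘ fmor (unshift D) h ∘ e').
apply: unshift_inj; have [d [de ed]] := ise Y.
have := nat _ _ (eta Y ∘ fmor (unshift D) h ∘ e').
rewrite /= -compA e'e compm1 => /(congr1 (fun u => d ∘ u)).
by rewrite !compA de !comp1m => e; symmetry.
Qed.

Lemma shift_reflect_isom X Y : isom (shift D X) (shift D Y) -> isom X Y.
Proof.
move=> [f0 [g0 [gf fg]]].
have [f ef] := shift_full f0; have [g eg] := shift_full g0.
by exists f, g; split; apply: shift_inj; rewrite fmorM fmor1 ef eg.
Qed.

Lemma isom_shift X Y : isom X Y <-> isom (shift D X) (shift D Y).
Proof. by split; [apply: fobj_isom|apply: shift_reflect_isom]. Qed.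

Lemma hom0_shift X Y : hom0 X Y <-> hom0 (shift D X) (shift D Y).
Proof.
split=> h f; first by have [f0 <-] := shift_full f; rewrite (h f0) shift0.
by apply: shift_inj; rewrite shift0; apply: h.
Qed.

Lemma zero_shift X : is_zero X <-> is_zero (shift D X).
Proof.
split; first exact: fobj_zero shift_additive _.
by move=> sX0; apply: hom0_id; apply/hom0_shift; apply: hom0_zerol.
Qed.

Lemma isom_shiftzS k X : isom (shiftz (k + 1) X) (shift D (shiftz k X)).
Proof.
case: k => [n|[|n]]; first by rewrite -PoszD addn1; apply: isom_refl.
  by apply: isom_sym; apply: isom_shiftK.
rewrite (_ : Negz n.+1 + 1 = Negz n).
  by apply: isom_sym; apply: isom_shiftK.
by rewrite !NegzE -[n.+2]addn1 PoszD opprD subrK.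
Qed.

Lemma isom_shiftz k X Y : isom X Y -> isom (shiftz k X) (shiftz k Y).
Proof.
move=> XY; elim/int_updown: k => // k; split.
  move=> /isom_shift h; apply: isom_trans (isom_shiftzS _ _) _.
  by apply: isom_trans h _; apply: isom_sym; apply: isom_shiftzS.
move=> h; apply/isom_shift; apply: isom_trans (isom_sym (isom_shiftzS _ _)) _.
by apply: isom_trans h _; apply: isom_shiftzS.
Qed.

Lemma isom_shiftz_updown (F : int -> D) X :
  isom (F 0) X -> (forall k, isom (F (k + 1)) (shift D (F k))) ->
  forall k, isom (F k) (shiftz k X).
Proof.
move=> F0 FS; elim/int_updown => // k; split=> [h|h].
  apply: isom_trans (FS k) _; apply: isom_sym.
  by apply: isom_trans (isom_shiftzS k X) _; apply: fobj_isom; apply: isom_sym.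
apply/isom_shift; apply: isom_trans (isom_sym (FS k)) _.
by apply: isom_trans h _; apply: isom_shiftzS.
Qed.

Lemma isom_shiftzD k l X : isom (shiftz (k + l) X) (shiftz k (shiftz l X)).
Proof.
apply: (isom_shiftz_updown (F := fun k => shiftz (k + l) X)) => [|j].
  by rewrite add0r; apply: isom_refl.
by rewrite addrAC; apply: isom_shiftzS.
Qed.

Lemma shiftz_updown (P : D -> Prop) k X :
  (forall X Y, isom X Y -> P X -> P Y) -> (forall X, P X <-> P (shift D X)) ->
  P X <-> P (shiftz k X).
Proof.
move=> Piso Psh; elim/int_updown: k => // k.
have e := isom_shiftzS k X; have Pk := Psh (shiftz k X).
have Pe : P (shift D (shiftz k X)) <-> P (shiftz (k + 1) X).
  by split; apply: Piso => //; apply: isom_sym.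
by split=> h; [rewrite h Pk|rewrite h -Pe -Pk].
Qed.

Lemma shiftz_updown2 (P : D -> D -> Prop) k X Y :
  (forall X Y X' Y', isom X X' -> isom Y Y' -> P X Y -> P X' Y') ->
  (forall X Y, P X Y <-> P (shift D X) (shift D Y)) ->
  P X Y <-> P (shiftz k X) (shiftz k Y).
Proof.
move=> Piso Psh; elim/int_updown: k => // k.
have e := isom_shiftzS k X; have e' := isom_shiftzS k Y.
have Pk := Psh (shiftz k X) (shiftz k Y).
have Pe : P (shift D (shiftz k X)) (shift D (shiftz k Y)) <->
    P (shiftz (k + 1) X) (shiftz (k + 1) Y).
  by split; apply: Piso => //; apply: isom_sym.
by split=> h; [rewrite h Pk|rewrite h -Pe -Pk].
Qed.

Lemma hom0_shiftz k X Y : hom0 X Y <-> hom0 (shiftz k X) (shiftz k Y).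
Proof.
apply: shiftz_updown2; last exact: hom0_shift.
by move=> *; apply: hom0_isom; eassumption.
Qed.

Lemma zero_shiftz k X : is_zero X <-> is_zero (shiftz k X).
Proof. by apply: shiftz_updown; [exact: is_zero_isom|exact: zero_shift]. Qed.

Lemma isom_shiftzN k X : isom (shiftz k (shiftz (- k) X)) X.
Proof. by have := isom_shiftzD k (- k) X; rewrite subrr; apply: isom_sym. Qed.

Lemma isom_shiftNz k X : isom (shiftz (- k) (shiftz k X)) X.
Proof. by have := isom_shiftzD (- k) k X; rewrite addNr; apply: isom_sym. Qed.

Lemma shiftedP k (P : D -> Prop) X : (forall X Y, isom X Y -> P X -> P Y) ->
  shifted k P X <-> P (shiftz (- k) X).
Proof.
move=> Piso; split=> [[Y [PY XY]]|PX].
  apply: Piso PY; apply: isom_trans (isom_sym (isom_shiftNz k Y)) _.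
  by apply/isom_shiftz/isom_sym.
by exists (shiftz (- k) X); split=> //; apply/isom_sym/isom_shiftzN.
Qed.

End Shift.

Section Triangles.
Variables (K : fieldType) (D : tricat K).
Implicit Types X Y Z W : D.
Notation sh := (fmor (shift D)).

Section Exactness.
Variables (X Y Z : D) (f : Hom X Y) (g : Hom Y Z) (h : Hom Z (shift D X)).
Hypothesis dfgh : dist f g h.

Lemma dist_rot1 : dist g h (- sh f).
Proof. exact: (proj1 (dist_rot f g h)). Qed.

Lemma dist_rot2 : dist h (- sh f) (- sh g).
Proof. exact: (proj1 (dist_rot _ _ _) dist_rot1). Qed.

Lemma dist_gf : g ∘ f = 0.
Proof.
have [[Z0 zZ0] _] := tcat_additive D.
have [] := dist_mor (a := idm X) (b := f) (dist_id X zZ0) dfgh (erefl _).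
by move=> c [<- _]; rewrite comp0r.
Qed.

End Exactness.

Lemma dist_hg X Y Z (f : Hom X Y) (g : Hom Y Z) h : dist f g h -> h ∘ g = 0.
Proof. by move=> /dist_rot1/dist_gf. Qed.

Lemma dist_fh X Y Z (f : Hom X Y) (g : Hom Y Z) h : dist f g h -> sh f ∘ h = 0.
Proof.
move=> /dist_rot2/dist_gf; rewrite compNl => e.
by rewrite -[LHS]opprK e oppr0.
Qed.

Lemma dist_zerol X Z0 : is_zero Z0 ->
  dist (0 : Hom Z0 X) (idm X) (0 : Hom X (shift D Z0)).
Proof.
move=> zZ0; apply: (proj2 (dist_rot _ _ _)); rewrite shift0 oppr0.
by apply: dist_id; apply: (proj1 (zero_shift _)).
Qed.

(** Exactness of Hom(W, -): [u] and 0 start a morphism from a rotated identity triangle of [W], and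
    its third component desuspends to the lift. *)
Lemma dist_liftf X Y Z W (f : Hom X Y) (g : Hom Y Z) h (u : Hom W Y) :
  dist f g h -> g ∘ u = 0 -> exists v : Hom W X, f ∘ v = u.
Proof.
move=> d gu; have [[Z0 zZ0] _] := tcat_additive D.
have d1 := dist_rot1 (dist_id W zZ0).
have [] := dist_mor (a := u) (b := (0 : Hom Z0 Z)) d1 (dist_rot1 d).
  by rewrite comp0r.
move=> c [_]; have [v <-] := shift_full c.
rewrite fmor1 compNr compm1 compNl -fmorM => /oppr_inj/shift_inj fv.
by exists v.
Qed.

Lemma dist_factg X Y Z W (f : Hom X Y) (g : Hom Y Z) h (u : Hom Y W) :
  dist f g h -> u ∘ f = 0 -> exists v : Hom Z W, v ∘ g = u.
Proof.
move=> d uf; have [[Z0 zZ0] _] := tcat_additive D.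
have [] := dist_mor (a := (0 : Hom X Z0)) (b := u) d (dist_zerol W zZ0).
  by rewrite uf comp0l.
by move=> c [e _]; exists c; rewrite e comp1m.
Qed.

Lemma dist_liftg X Y Z W (f : Hom X Y) (g : Hom Y Z) h (u : Hom W Z) :
  dist f g h -> h ∘ u = 0 -> exists v : Hom W Y, g ∘ v = u.
Proof. by move=> /dist_rot1; apply: dist_liftf. Qed.

Lemma dist_facth X Y Z W (f : Hom X Y) (g : Hom Y Z) h (u : Hom Z W) :
  dist f g h -> u ∘ g = 0 -> exists v : Hom (shift D X) W, v ∘ h = u.
Proof. by move=> /dist_rot1; apply: dist_factg. Qed.

Lemma dist_lifth X Y Z W (f : Hom X Y) (g : Hom Y Z) h
    (u : Hom W (shift D X)) :
  dist f g h -> sh f ∘ u = 0 -> exists v : Hom W Z, h ∘ v = u.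
Proof.
by move=> /dist_rot2 d e; apply: dist_liftf d _; rewrite compNl e oppr0.
Qed.

Section SquareZero.
Variables (X : D) (n : Hom X X).
Hypothesis n2 : n ∘ n = 0.

Lemma is_iso_1D : is_iso (idm X + n).
Proof.
exists (idm X - n).
rewrite !compDl !compDr !compNl !compNr !comp1m !compm1 n2 oppr0 !addr0.
by rewrite subrK addrK.
Qed.

End SquareZero.

(* If [c] and [c'] are induced on cones in both directions, then [c' c - 1]
   has square zero, so that [c' c] and [c c'] are invertible. *)
Lemma cone_uniq X Y Z X' Y' Z' (f : Hom X Y) (g : Hom Y Z) h
    (f' : Hom X' Y') (g' : Hom Y' Z') h' (a : Hom X X') (b : Hom Y Y') :
  dist f g h -> dist f' g' h' -> is_iso a -> is_iso b -> b ∘ f = f' ∘ a ->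
  exists c : Hom Z Z', [/\ is_iso c, c ∘ g = g' ∘ b & sh a ∘ h = h' ∘ c].
Proof.
move=> d d' [a' [a'a aa']] [b' [b'b bb']] e.
have [c [c1 c2]] := dist_mor d d' e.
have e' : b' ∘ f' = f ∘ a'.
  by rewrite -[f]comp1m -b'b -(compA b') e -!compA aa' compm1.
have [c' [c1' c2']] := dist_mor d' d e'.
exists c; split=> //.
have key U V T (u : Hom U V) (v : Hom V T) (w : Hom T (shift D U)) (x : Hom T T) :
    dist u v w -> x ∘ v = v -> w ∘ x = w -> is_iso x.
  move=> duvw xv wx; rewrite -[x](subrK (idm T)) addrC; apply: is_iso_1D.
  have [|y y1] := dist_facth (u := x - idm T) duvw.
    by rewrite compBl xv comp1m subrr.
  by rewrite -{1}y1 -compA compBr wx compm1 subrr comp0r.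
have [] : is_iso (c' ∘ c).
  apply: (key _ _ _ f g h) => //.
    by rewrite -compA c1 compA c1' -compA b'b compm1.
  by rewrite compA -c2' -compA -c2 compA -fmorM a'a fmor1 comp1m.
move=> l [l1 _].
have [] : is_iso (c ∘ c').
  apply: (key _ _ _ f' g' h') => //.
    by rewrite -compA c1' compA c1 -compA bb' compm1.
  by rewrite compA -c2 -compA -c2' compA -fmorM aa' fmor1 comp1m.
move=> r [_ r1].
by apply: (is_iso_LR (l := l ∘ c') (r := c' ∘ r)); rewrite ?compA // -compA.
Qed.

Lemma shift_iso_reflect X Y (f : Hom X Y) : is_iso (sh f) -> is_iso f.
Proof.
move=> [g0 [gf fg]]; have [g eg] := shift_full g0.
by exists g; split; apply: shift_inj; rewrite fmorM fmor1 eg.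
Qed.

Lemma cocone_uniq X Y Z X' Y' Z' (f : Hom X Y) (g : Hom Y Z) h
    (f' : Hom X' Y') (g' : Hom Y' Z') h' (b : Hom Y Y') (c : Hom Z Z') :
  dist f g h -> dist f' g' h' -> is_iso b -> is_iso c -> c ∘ g = g' ∘ b ->
  exists a : Hom X X', [/\ is_iso a & b ∘ f = f' ∘ a].
Proof.
move=> /dist_rot1 d /dist_rot1 d' isob isoc e.
have [a0 [isoa0 _]] := cone_uniq d d' isob isoc e.
have [a ea] := shift_full a0; rewrite -ea compNl compNr => /oppr_inj.
rewrite -!fmorM => /shift_inj ba; exists a; split=> //.
by apply: shift_iso_reflect; rewrite ea.
Qed.

Lemma dist_unrot3 X Y Z (f : Hom X Y) (g : Hom Y Z) (h : Hom Z (shift D X)) :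
  dist (- sh f) (- sh g) (- sh h) -> dist f g h.
Proof. by move=> d; do 3! apply: (proj2 (dist_rot _ _ _)). Qed.

Lemma dist_sign X Y Z (f : Hom X Y) (g : Hom Y Z) (h : Hom Z (shift D X)) :
  dist f g h -> dist (- f) (- g) h.
Proof.
apply: (dist_iso (a := idm X) (b := - idm Y) (c := idm Z));
  rewrite ?fmor1 ?compNl ?compNr ?comp1m ?compm1 ?opprK //.
- exact: is_iso_id.
- by apply/is_iso_opp/is_iso_id.
- exact: is_iso_id.
Qed.

Lemma cocone_ex Y Z (g : Hom Y Z) : exists X (f : Hom X Y) h, dist f g h.
Proof.
have [W [h0 [f0 d]]] := dist_cone g.
have [i [j [ji ij]]] := isom_shiftK W.
have [f ef] := shift_full (- f0 ∘ i).
exists (unshift D W), f, (j ∘ h0); apply: (proj2 (dist_rot _ _ _)); rewrite ef.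
apply: (dist_iso (a := idm Y) (b := idm Z) (c := j)) d;
  rewrite ?comp1m ?compm1 ?fmor1 ?comp1m //; try exact: is_iso_id.
- by exists i.
- by rewrite !compNl opprK -compA ij compm1.
Qed.

(* Octahedral axiom for X --g--> Z --p--> Z1, in terms of fibres. *)
Lemma oct_cocone X Y Z Z' Z1 X' (f : Hom Y X) (g : Hom X Z) h
    (f' : Hom Z' Z) (p : Hom Z Z1) h' (f'' : Hom X' X) h'' :
  dist f g h -> dist f' p h' -> dist f'' (p ∘ g) h'' ->
  exists (u : Hom Y X') (v : Hom X' Z'),
    [/\ dist u v (h ∘ f'), f'' ∘ u = f & f' ∘ v = g ∘ f''].
Proof.
move=> d d' d''.
have [u0 [v0 []]] := dist_oct (dist_rot1 d) (dist_rot1 d') (dist_rot1 d'').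
have [u eu] := shift_full u0; have [v ev] := shift_full v0.
rewrite -eu -ev !compNl !compNr => du _ /oppr_inj e1 _ /oppr_inj e2.
exists u, v; split.
- by apply: dist_unrot3; apply: dist_sign; rewrite fmorM.
- by apply: shift_inj; rewrite fmorM.
- by apply: shift_inj; rewrite !fmorM.
Qed.

(* Octahedral axiom for Y1 --f--> X --g--> S, in terms of the cone of f and
   the fibres of g and of g f. *)
Lemma oct_mid X Y1 S1 Y S W (f : Hom Y1 X) (g1 : Hom X S1) h1
    (y : Hom Y X) (g : Hom X S) h (w : Hom W Y1) h' :
  dist f g1 h1 -> dist y g h -> dist w (g ∘ f) h' ->
  exists (u : Hom W Y) k, dist u (g1 ∘ y) k /\ y ∘ u = f ∘ w.
Proof.
move=> d1 d /dist_rot1 d'.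
have [u0 [v0 []]] := dist_oct d1 (dist_rot1 d) d'.
have [v <-] := shift_full v0; rewrite !compNl !compNr => du _ _ _ /oppr_inj.
rewrite -!fmorM => /shift_inj e.
exists v, (- u0); split=> //; do 2! apply: (proj2 (dist_rot _ _ _)).
by rewrite fmorM; apply: dist_sign.
Qed.

Lemma dist_split_sec X Y Z (f : Hom X Y) (g : Hom Y Z) (s : Hom Z Y) :
  dist f g (0 : Hom Z (shift D X)) -> g ∘ s = idm Z ->
  exists r : Hom Y X,
    [/\ r ∘ f = idm X, r ∘ s = 0 & f ∘ r + s ∘ g = idm Y].
Proof.
move=> d gs; have gf := dist_gf d.
have [|r fr] := dist_liftf (u := idm Y - s ∘ g) d.
  by rewrite compBr compm1 compA gs comp1m subrr.
(* The connecting map is zero, so [f] is a monomorphism: the shift of a map killed by [f] factors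
   through that connecting map. *)
have finj W (u v : Hom W X) : f ∘ u = f ∘ v -> u = v.
  move=> /eqP; rewrite -subr_eq0 -compBr => /eqP fuv.
  apply/eqP; rewrite -subr_eq0; apply/eqP.
  have [|w] := dist_lifth (u := sh (u - v)) d.
    by rewrite -fmorM fuv shift0.
  by rewrite comp0l -shift0 => /shift_inj.
exists r; split.
- apply: finj; rewrite compA fr compBl -compA gf.
  by rewrite comp1m comp0r subr0 compm1.
- apply: finj; rewrite compA fr compBl -compA gs.
  by rewrite comp1m compm1 subrr comp0r.
- by rewrite fr subrK.
Qed.

Lemma dist_split X Y Z (f : Hom X Y) (g : Hom Y Z) :
  dist f g (0 : Hom Z (shift D X)) ->
  exists (r : Hom Y X) (s : Hom Z Y),
    [/\ r ∘ f = idm X, g ∘ s = idm Z, r ∘ s = 0, g ∘ f = 0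
      & f ∘ r + s ∘ g = idm Y].
Proof.
move=> d; have [|s gs] := dist_liftg (u := idm Z) d; first by rewrite comp0l.
have [r [rf rs e]] := dist_split_sec d gs.
by exists r, s; split=> //; apply: dist_gf d.
Qed.

Lemma dist_split_biprod X Y Z (f : Hom X Y) (g : Hom Y Z) :
  dist f g (0 : Hom Z (shift D X)) -> is_biprod X Z Y.
Proof.
move=> /dist_split [r [s [e1 e2 e3 e4 e5]]].
by exists f, s, r, g.
Qed.

Lemma dist_retraction X Y Z (f : Hom X Y) (g : Hom Y Z) h (r : Hom Y X) :
  dist f g h -> r ∘ f = idm X -> h = 0.
Proof.
move=> d rf; have := congr1 (comp (sh r)) (dist_fh d).
by rewrite compA -fmorM rf fmor1 comp1m comp0r.
Qed.

Lemma dist_section X Y Z (f : Hom X Y) (g : Hom Y Z) h (s : Hom Z Y) :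
  dist f g h -> g ∘ s = idm Z -> h = 0.
Proof.
by move=> d gs; rewrite -[h]compm1 -gs compA (dist_hg d) comp0l.
Qed.

(** The triangle on the cone of [i1] splits, and the map from the cone to [Y] induced by [p2] has
    inverse [g i2]; the cone is then replaced by [Y] along it. *)
Lemma biprod_dist X Y B (i1 : Hom X B) (i2 : Hom Y B) (p1 : Hom B X)
    (p2 : Hom B Y) :
  [/\ p1 ∘ i1 = idm X, p2 ∘ i2 = idm Y, p1 ∘ i2 = 0, p2 ∘ i1 = 0
      & i1 ∘ p1 + i2 ∘ p2 = idm B] -> dist i1 p2 0.
Proof.
move=> [e1 e2 e3 e4 e5]; have [Z [g [h d]]] := dist_cone i1.
have h0 := dist_retraction d e1.
have [c cg] := dist_factg d e4.
have isoc : is_iso c.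
  exists (g ∘ i2); split; last by rewrite compA cg.
  have [r [s [_ gs _ gi1 _]]] : exists (r : Hom B X) (s : Hom Z B),
      [/\ r ∘ i1 = idm X, g ∘ s = idm Z, r ∘ s = 0, g ∘ i1 = 0
        & i1 ∘ r + s ∘ g = idm B] by apply: dist_split; rewrite -h0.
  have e : g ∘ i2 ∘ c ∘ g = g.
    rewrite -compA cg -compA.
    have -> : i2 ∘ p2 = idm B - i1 ∘ p1 by rewrite -e5 addrC addKr.
    by rewrite compBr compm1 compA gi1 comp0l subr0.
  by rewrite -[LHS]compm1 -gs compA e.
apply: (dist_iso (a := idm X) (b := idm B) (c := c)) d => //;
  rewrite ?comp1m ?compm1 ?comp0l ?fmor1 ?comp1m //; exact: is_iso_id.
Qed.

Lemma dist_section_dist X Y Z (f : Hom X Y) (g : Hom Y Z) h (s : Hom Z Y) :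
  dist f g h -> g ∘ s = idm Z ->
  exists2 r : Hom Y X, r ∘ f = idm X & dist s r 0.
Proof.
move=> d gs; have h0 := dist_section d gs; rewrite h0 in d.
have [r [rf rs e]] := dist_split_sec d gs; exists r => //.
apply: (biprod_dist (p1 := g) (i2 := f)); split=> //; first exact: dist_gf d.
by rewrite addrC.
Qed.

(** The obstruction to extending [u] along [f] is the composite of [h] with the shift of [u], an
    element of Hom(Z, Sigma W). *)
Lemma dist_factf X Y Z W (f : Hom X Y) (g : Hom Y Z) h (u : Hom X W) :
  dist f g h -> hom0 Z (shift D W) -> exists v : Hom Y W, v ∘ f = u.
Proof.
move=> /dist_rot2 d ZW.
have [|v0] := dist_factg (u := sh u) d; first exact: ZW.
have [v <-] := shift_full v0; rewrite compNr -fmorM -shiftN => /shift_inj e.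
by exists (- v); rewrite compNl.
Qed.

Lemma retract_summand X B : retract X B -> exists X', is_biprod X X' B.
Proof.
move=> [i [p pi]]; have [Z [g [h d]]] := dist_cone i.
have h0 := dist_retraction d pi; rewrite h0 in d.
by exists Z; apply: dist_split_biprod d.
Qed.

Definition tri X Y Z :=
  exists (f : Hom X Y) (g : Hom Y Z) (h : Hom Z (shift D X)), dist f g h.

Lemma tri_isom X Y Z X' Y' Z' : isom X X' -> isom Y Y' -> isom Z Z' ->
  tri X Y Z -> tri X' Y' Z'.
Proof.
move=> [a isoa] [b isob] [c isoc] [f [g [h d]]].
have [a' [a'a aa']] := isoa; have [b' [b'b bb']] := isob.
have [c' [c'c cc']] := isoc.
exists (b ∘ f ∘ a'), (c ∘ g ∘ b'), (sh a ∘ h ∘ c').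
apply: (dist_iso isoa isob isoc) d; rewrite -compA ?a'a ?b'b ?c'c ?compm1 //.
Qed.

Lemma tri_biprod X Y B : is_biprod X Y B -> tri X B Y.
Proof.
by move=> [i1 [i2 [p1 [p2 /biprod_dist d]]]]; exists i1, p2, 0.
Qed.

Lemma tri_rot X Y Z : tri X Y Z -> tri Y Z (shift D X).
Proof. by move=> [f [g [h /dist_rot1 d]]]; exists g, h, (- sh f). Qed.

Lemma tri_zerol X Z : is_zero X -> tri X Z Z.
Proof. by move=> X0; do 3! eexists; apply: dist_zerol. Qed.

Lemma tri_zeror X Z : is_zero Z -> tri X X Z.
Proof. by move=> Z0; do 3! eexists; apply: dist_id. Qed.

Lemma tri_shift X Y Z :
  tri X Y Z <-> tri (shift D X) (shift D Y) (shift D Z).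
Proof.
split; first by move=> /tri_rot/tri_rot/tri_rot.
move=> [f0 [g0 [h0]]].
have [f ef] := shift_full (- f0); have [g eg] := shift_full (- g0).
have [h eh] := shift_full (- h0).
by exists f, g, h; apply: dist_unrot3; rewrite ef eg eh !opprK.
Qed.

Lemma tri_shiftz k X Y Z : tri X Y Z <-> tri (shiftz k X) (shiftz k Y) (shiftz k Z).
Proof.
elim/int_updown: k => // k.
have Pk := tri_shift (shiftz k X) (shiftz k Y) (shiftz k Z).
have Pe : tri (shift D (shiftz k X)) (shift D (shiftz k Y)) (shift D (shiftz k Z))
    <-> tri (shiftz (k + 1) X) (shiftz (k + 1) Y) (shiftz (k + 1) Z).
  by split; apply: tri_isom; [..|apply: isom_sym|apply: isom_sym|apply: isom_sym];
     try (apply: isom_shiftzS); apply: isom_sym; apply: isom_shiftzS.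
by split=> h; [rewrite h Pk|rewrite h -Pe -Pk].
Qed.

Lemma tri_zero_mid X Y Z : tri X Y Z -> is_zero X -> is_zero Z -> is_zero Y.
Proof.
move=> [f [g [h d]]] X0 Z0; apply: hom0_id => u.
have [|v <-] := dist_liftf (u := u) d; first exact: hom0_zeror.
by rewrite (hom0_zerol X0 f) comp0l.
Qed.

Lemma tri_zero_isom X Y Z : tri X Y Z -> is_zero Z -> isom X Y.
Proof.
move=> [f [g [h d]]] Z0.
have [|a [isoa _]] := cocone_uniq d (dist_id Y Z0) (is_iso_id Y) (is_iso_id Z).
  by rewrite (hom0_zeror Z0 g) comp0r comp0l.
by exists a.
Qed.

Lemma tri_zero_isoml X Y Z : tri X Y Z -> is_zero X -> isom Y Z.
Proof.
move=> /tri_rot/tri_zero_isom h X0; apply: h.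
exact: (proj1 (zero_shift _)).
Qed.

Lemma tri_hom0_mid X Y Z W : tri X Y Z -> hom0 W X -> hom0 W Z -> hom0 W Y.
Proof.
move=> [f [g [h d]]] WX WZ u.
have [|v <-] := dist_liftf (u := u) d; first exact: WZ.
by rewrite (WX v) comp0r.
Qed.

Lemma tri_hom0_midl X Y Z W : tri X Y Z -> hom0 X W -> hom0 Z W -> hom0 Y W.
Proof.
move=> [f [g [h d]]] XW ZW u.
have [|v <-] := dist_factg (u := u) d; first exact: XW.
by rewrite (ZW v) comp0l.
Qed.

Lemma tri_hom0_left X Y Z W :
  tri X Y Z -> hom0 W Y -> hom0 (shift D W) Z -> hom0 W X.
Proof.
move=> /tri_rot t WY WZ; apply/hom0_shift; apply: tri_hom0_mid (tri_rot t) WZ _.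
exact: (proj1 (hom0_shift _ _)).
Qed.

(** By the octahedral axiom for [g p1], [W] is an extension of [Y] and [X'] whose connecting map
    factors through the zero connecting map of the split triangle on [p1]. *)
Lemma biprod_fibre X Y Z (f : Hom Y X) (g : Hom X Z) h X' X1
    (i1 : Hom X X1) (i2 : Hom X' X1) (p1 : Hom X1 X) (p2 : Hom X1 X') :
  dist f g h ->
  [/\ p1 ∘ i1 = idm X, p2 ∘ i2 = idm X', p1 ∘ i2 = 0, p2 ∘ i1 = 0
      & i1 ∘ p1 + i2 ∘ p2 = idm X1] ->
  forall W (w : Hom W X1) k, dist w (g ∘ p1) k -> is_biprod Y X' W.
Proof.
move=> d [e1 e2 e3 e4 e5] W w k dw.
have d2 : dist i2 p1 0.
  by apply: biprod_dist; split; [exact: e2|exact: e1|..] => //; rewrite addrC.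
have [u [v [duv wu _]]] := oct_cocone d2 d dw.
apply: biprod_sym; move: duv; rewrite comp0l; exact: dist_split_biprod.
Qed.

Lemma tri_biprodl X Y Z X' Y1 : tri Y X Z -> is_biprod Y X' Y1 ->
  exists2 X1, is_biprod X X' X1 & tri Y1 X1 Z.
Proof.
move=> [f [g [h d]]] bY; have [_ ex] := tcat_additive D.
have [X1 bX] := ex X X'; exists X1 => //.
have [i1 [i2 [p1 [p2 e]]]] := bX.
have [W [w [k dw]]] := cocone_ex (g ∘ p1).
have bW := biprod_fibre d e dw.
apply: (tri_isom (biprod_uniq bW bY) (isom_refl _) (isom_refl _)).
by exists w, (g ∘ p1), k.
Qed.

Lemma tri_biprodr X Y Z X' Z1 : tri Y X Z -> is_biprod Z X' Z1 ->
  exists2 X1, is_biprod X X' X1 & tri Y X1 Z1.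
Proof.
move=> [f [g [h d]]] bZ; have [_ ex] := tcat_additive D.
have [X1 bX] := ex X X'; exists X1 => //.
have [i1 [i2 [p1 [p2 e]]]] := bX.
have [W [w [k dw]]] := dist_cone (i1 ∘ f).
have [u [v [duv _ _ _ _]]] := dist_oct d (biprod_dist e) dw.
have bW : is_biprod Z X' W.
  by move: duv; rewrite comp0r; exact: dist_split_biprod.
apply: (tri_isom (isom_refl _) (isom_refl _) (biprod_uniq bW bZ)).
by exists (i1 ∘ f), w, k.
Qed.

(** Complements of the two ends are added to the triangle as direct summands. This makes [built]
    stable under extensions. *)
Lemma tri_retract X Y Z Y1 Z1 : tri Y X Z -> retract Y Y1 -> retract Z Z1 ->
  exists2 X1, retract X X1 & tri Y1 X1 Z1.
Proof.
move=> t /retract_summand[Y' bY] /retract_summand[Z' bZ].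
have [X1 bX1 t1] := tri_biprodl t bY.
have [X2 bX2 t2] := tri_biprodr t1 bZ; exists X2 => //.
exact: retract_trans (biprod_retract bX1) (biprod_retract bX2).
Qed.

(** The octahedral axiom as associativity of extensions, [Y * (Z' * Z1) = (Y * Z') * Z1];
    [tri_assocV] is the other direction. *)
Lemma tri_assoc Y X Z Z' Z1 : tri Y X Z -> tri Z' Z Z1 ->
  exists2 X', tri Y X' Z' & tri X' X Z1.
Proof.
move=> [f [g [h d]]] [f' [p [h' d']]].
have [X' [f'' [h'' d'']]] := cocone_ex (p ∘ g).
have [u [v [duv _ _]]] := oct_cocone d d' d''.
by exists X'; [exists u, v, (h ∘ f')|exists f'', (p ∘ g), h''].
Qed.

Lemma tri_assocV Y' Y X A B : tri Y' Y A -> tri Y X B ->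
  exists2 W, tri Y' X W & tri A W B.
Proof.
move=> [f [f1 [f2 d]]] [g [g1 [g2 d']]].
have [W [w [k dw]]] := dist_cone (g ∘ f).
have [u [v [duv _ _ _ _]]] := dist_oct d d' dw.
by exists W; [exists (g ∘ f), w, k|exists u, v, (sh f1 ∘ g2)].
Qed.

Lemma tri_swap A W B : tri A W B -> hom0 B (shift D A) -> tri B W A.
Proof.
move=> [f [g [h d]]] BA; move: d; rewrite (BA h) => /dist_split_biprod bW.
exact: tri_biprod (biprod_sym bW).
Qed.

End Triangles.

(** * Filtrations *)

Section Filtrations.
Variables (K : fieldType) (D : tricat K).
Implicit Types X Y Z W G F : D.

(* The head of the list is the label of the outermost quotient. *)
Inductive filt (fac : int -> D -> Prop) : seq int -> D -> Prop :=
| filt_nil X : is_zero X -> filt fac [::] X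
| filt_cons k ks Y X Z (f : Hom Y X) (g : Hom X Z) (h : Hom Z (shift D Y)) :
    filt fac ks Y -> fac k Z -> dist f g h -> filt fac (k :: ks) X.

Section OneClass.
Variable fac : int -> D -> Prop.

Lemma filt_nilE X : filt fac [::] X -> is_zero X.
Proof. by move=> H; inversion H. Qed.

Lemma filt_consE k ks X : filt fac (k :: ks) X ->
  exists Y Z (f : Hom Y X) (g : Hom X Z) (h : Hom Z (shift D Y)),
    [/\ filt fac ks Y, fac k Z & dist f g h].
Proof.
move E : (k :: ks) => s H; case: H E => // k' ks' Y X' Z f g h fY fZ d [-> ->].
by exists Y, Z, f, g, h.
Qed.

Lemma filt_tri k ks Y X Z :
  filt fac ks Y -> fac k Z -> tri Y X Z -> filt fac (k :: ks) X.
Proof. by move=> fY fZ [f [g [h d]]]; apply: filt_cons fY fZ d. Qed.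

Lemma filt_triE k ks X : filt fac (k :: ks) X ->
  exists Y Z, [/\ filt fac ks Y, fac k Z & tri Y X Z].
Proof.
by move=> /filt_consE[Y [Z [f [g [h []]]]]] *; exists Y, Z; split=> //; exists f, g, h.
Qed.

Lemma filt_isom ks X X' : isom X X' -> filt fac ks X -> filt fac ks X'.
Proof.
case: ks => [|k ks] XX'.
  by move=> /filt_nilE X0; apply: filt_nil; apply: is_zero_isom X0.
move=> /filt_triE[Y [Z [fY fZ t]]]; apply: filt_tri fY fZ _.
by apply: tri_isom t => //; apply: isom_refl.
Qed.

Lemma filt_one k Z : fac k Z -> filt fac [:: k] Z.
Proof.
have [[N0 zN0] _] := tcat_additive D.
by move=> fZ; apply: filt_tri (filt_nil _ zN0) fZ _; apply: tri_zerol.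
Qed.

Lemma filt_cat ks ls Y X Z : filt fac ks Y -> filt fac ls Z -> tri Y X Z ->
  filt fac (ls ++ ks) X.
Proof.
move=> fY; elim: ls X Z => [|l ls IH] X Z.
  by move=> /filt_nilE Z0 /tri_zero_isom/(_ Z0) YX; apply: filt_isom fY.
move=> /filt_triE[Z' [Z1 [fZ' fZ1 t1]]] t.
have [X' t2 t3] := tri_assoc t t1.
exact: filt_tri (IH _ _ fZ' t2) fZ1 t3.
Qed.

Lemma filt_split ks ls X : filt fac (ls ++ ks) X ->
  exists Y Z, [/\ filt fac ks Y, filt fac ls Z & tri Y X Z].
Proof.
elim: ls X => [|l ls IH] X.
  have [[N0 zN0] _] := tcat_additive D.
  move=> fX; exists X, N0; split=> //; first exact: filt_nil.
  exact: tri_zeror.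
move=> /filt_triE[X1 [Z1 [/IH[Y [Z [fY fZ t]]] fZ1 t1]]].
have [W t2 t3] := tri_assocV t t1.
by exists Y, W; split=> //; apply: filt_tri fZ fZ1 t3.
Qed.

Lemma filt_shiftz j ks X :
  (forall k Z, fac k Z -> fac (j + k) (shiftz j Z)) ->
  filt fac ks X -> filt fac [seq j + k | k <- ks] (shiftz j X).
Proof.
move=> facS; elim: ks X => [|k ks IH] X.
  by move=> /filt_nilE X0; apply: filt_nil; apply: (proj1 (zero_shiftz _ _)).
move=> /filt_triE[Y [Z [fY fZ t]]].
exact: filt_tri (IH _ fY) (facS _ _ fZ) (proj1 (tri_shiftz j _ _ _) t).
Qed.

Lemma filt_closed (P : D -> Prop) ks X :
  (forall X, is_zero X -> P X) -> (forall k Z, k \in ks -> fac k Z -> P Z) ->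
  (forall X Y Z, tri X Y Z -> P X -> P Z -> P Y) ->
  filt fac ks X -> P X.
Proof.
move=> P0 + Pt; elim: ks X => [|k ks IH] X Pfac; first by move=> /filt_nilE/P0.
move=> /filt_triE[Y [Z [fY fZ t]]]; apply: Pt t _ _.
  by apply: IH fY => k' Z' k'ks; apply: Pfac; rewrite inE k'ks orbT.
by apply: Pfac fZ; rewrite mem_head.
Qed.

Section Sorting.
Variable leT : rel int.
Hypotheses (leT_total : total leT) (leT_tr : transitive leT).
Hypothesis swap : forall k l A W B, fac k A -> fac l B -> ~~ leT l k ->
  tri A W B -> is_zero W \/ tri B W A.

(** One pass of insertion sort, carrying [l] inwards. [rest] collects the labels lost in
    cancellations, so that the weight can be compared with that of the original list. *)
Lemma filt_insert l ks Y X Z : sorted leT ks -> filt fac ks Y -> fac l Z ->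
  tri Y X Z -> exists ms rest,
    [/\ sorted leT ms, filt fac ms X & perm_eq (ms ++ rest) (l :: ks)].
Proof.
elim: ks Y X => [|k ks IH] Y X.
  move=> _ fY fZ t; exists [:: l], [::]; split=> //; exact: filt_tri fY fZ t.
rewrite /= path_sortedE // => /andP[kks sks] fY fZ t.
case lk: (leT l k).
  exists [:: l, k & ks], [::]; split; last by rewrite cats0.
    by rewrite /= lk path_sortedE // kks.
  exact: filt_tri fY fZ t.
have [Y' [A [fY' fA t1]]] := filt_triE fY.
have [W t2 t3] := tri_assocV t1 t.
(* If the two-step extension [W] vanishes, both labels are dropped and [X] is [Y']; otherwise [k]
   moves outside and [l] is inserted further in. *)
have [W0|t4] := swap fA fZ (negbT lk) t3.
  exists ks, [:: l; k]; split=> //; last by rewrite perm_catC.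
  exact: filt_isom (tri_zero_isom t2 W0) fY'.
have [X' t5 t6] := tri_assoc t2 t4.
have [ms [rest [sms fms p]]] := IH _ _ sks fY' fZ t5.
exists (k :: ms), rest; split; last first.
- rewrite cat_cons -(cat1s l) -(cat1s k ks) perm_sym perm_catCA /= perm_cons.
  by rewrite perm_sym.
- exact: filt_tri fms fA t6.
rewrite /= path_sortedE // sms andbT; apply/allP => m mms.
have : m \in l :: ks by rewrite -(perm_mem p) mem_cat mms.
rewrite inE => /predU1P[->|/(allP kks)//].
by have := leT_total k l; rewrite lk orbF.
Qed.

Lemma filt_sort ks X : filt fac ks X -> exists ms rest,
  [/\ sorted leT ms, filt fac ms X & perm_eq (ms ++ rest) ks].
Proof.
elim: ks X => [|k ks IH] X fX; first by exists [::], [::].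
have [Y [Z [/IH[ms [rest [sms fms p]]] fZ t]]] := filt_triE fX.
have [ms' [rest' [sms' fms' p']]] := filt_insert sms fms fZ t.
exists ms', (rest' ++ rest); split=> //; rewrite catA.
apply: (@perm_trans _ ((k :: ms) ++ rest)); first by rewrite perm_cat2r.
by rewrite /= perm_cons.
Qed.

End Sorting.
End OneClass.

Lemma filtration_nilE X : filtration [::] X -> is_zero X.
Proof.
move E : [::] => s H; case: H E => // Xs Y X' Z f g h _ _ E.
by have := congr1 size E; rewrite size_rcons.
Qed.

Lemma filtration_rconsE Xs A X : filtration (rcons Xs A) X ->
  exists Y, filtration Xs Y /\ tri Y X A.
Proof.
move E : (rcons Xs A) => s H; case: H E => [? _|Xs' Y X' Z f g h fY d].
  by move=> /(congr1 size); rewrite size_rcons.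
by move=> /rcons_inj[-> ->]; exists Y; split=> //; exists f, g, h.
Qed.

(** [filtration] lists the outermost factor last and [filt] lists it first, hence the reversal. *)
Lemma filtration_filt (fac : int -> D -> Prop) T (F : T -> D)
    (l : T -> seq int) fs X :
  (forall p, filt fac (l p) (F p)) -> filtration [seq F p | p <- fs] X ->
  filt fac (flatten [seq l p | p <- rev fs]) X.
Proof.
move=> Fl; elim/last_ind: fs X => [|fs p IH] X.
  by move=> /filtration_nilE; apply: filt_nil.
rewrite map_rcons rev_rcons /= => /filtration_rconsE[Y [/IH fY t]].
exact: filt_cat fY (Fl p) t.
Qed.

Lemma filtration_tri Xs Y X Z : filtration Xs Y -> tri Y X Z ->
  filtration (rcons Xs Z) X.
Proof. by move=> fY [f [g [h d]]]; apply: filtrationS fY d. Qed.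

Definition shifts_of G := fun k Z => isom Z (shiftz k G).

Lemma filtration_shifts G ks B :
  filtration [seq shiftz k G | k <- ks] B <-> filt (shifts_of G) (rev ks) B.
Proof.
split=> [fB|].
  rewrite -[rev ks]flatten_seq1; apply: filtration_filt fB => k.
  by apply: filt_one; apply: isom_refl.
elim/last_ind: ks B => [|ks k IH] B.
  by move=> /filt_nilE; apply: filtration0.
rewrite map_rcons rev_rcons => /filt_triE[Y [Z [/IH fY fZ t]]].
apply: filtration_tri fY _.
exact: tri_isom (isom_refl _) (isom_refl _) fZ t.
Qed.

(** Up to reversal ([filtration_shifts]), these are the lists over which [delta] takes its infimum,
    the summand being written as a retract. *)
Definition built G ks F := exists2 B, retract F B & filt (shifts_of G) ks B.

Lemma built_retract G ks F F' : retract F' F -> built G ks F -> built G ks F'.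
Proof. by move=> r [B rB fB]; exists B => //; apply: retract_trans rB. Qed.

Lemma built_zero G F : is_zero F -> built G [::] F.
Proof. by exists F; [apply: retract_refl|apply: filt_nil]. Qed.

Lemma built_tri G ks ls Y X Z : built G ks Y -> built G ls Z -> tri Y X Z ->
  built G (ls ++ ks) X.
Proof.
move=> [Y1 rY fY] [Z1 rZ fZ] t.
have [X1 rX t1] := tri_retract t rY rZ.
by exists X1 => //; apply: filt_cat fY fZ t1.
Qed.

Lemma shifts_of_shiftz G j k Z :
  shifts_of G k Z -> shifts_of G (j + k) (shiftz j Z).
Proof.
move=> /(isom_shiftz j) e; apply: isom_trans e _.
exact/isom_sym/isom_shiftzD.
Qed.

Lemma isom_shiftz_retract j X Y : retract X Y -> retract (shiftz j X) (shiftz j Y).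
Proof. by case: j => n; apply: fobj_retract. Qed.

Lemma built_shiftz G j ks F :
  built G ks F -> built G [seq j + k | k <- ks] (shiftz j F).
Proof.
move=> [B rB fB]; exists (shiftz j B); first exact: isom_shiftz_retract.
by apply: filt_shiftz fB => *; apply: shifts_of_shiftz.
Qed.

Lemma built_refl G : built G [:: 0] G.
Proof.
exists G; first exact: retract_refl.
by apply: filt_one; apply: isom_refl.
Qed.

(** Substituting a construction of [F] from [G] into one of [X] from [F] adds degrees pairwise, so
    weights multiply ([weight_allpairs]): the source of submultiplicativity. *)
Lemma built_comp G ks F ls X : built G ks F -> built F ls X ->
  built G [seq l + k | l <- ls, k <- ks] X.
Proof.
move=> bF [B rB fB]; apply: built_retract rB _.
elim: ls B fB => [|l ls IH] B; first by move=> /filt_nilE; apply: built_zero.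
move=> /filt_triE[Y [Z [/IH fY fZ t]]]; rewrite allpairs_cons.
apply: built_tri fY _ t; apply: built_retract (isom_retract fZ) _.
exact: built_shiftz.
Qed.

(** The analogue of [built_comp] for simple or indecomposable factors. It stops at [B]: passing to a
    summand of [B] is the hard part and is done after sorting. *)
Lemma filt_built (fac : int -> D -> Prop) G ks ls B :
  (forall j k Z, fac k Z -> fac (j + k) (shiftz j Z)) ->
  filt fac ks G -> filt (shifts_of G) ls B ->
  filt fac [seq l + k | l <- ls, k <- ks] B.
Proof.
move=> facS fG; elim: ls B => [|l ls IH] B.
  by move=> /filt_nilE; apply: filt_nil.
move=> /filt_triE[Y [Z [/IH fY fZ t]]]; rewrite allpairs_cons.
apply: filt_cat fY _ t; apply: filt_isom (isom_sym fZ) _.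
by apply: filt_shiftz fG => *; apply: facS.
Qed.

(** For a split-generator this makes every object built from [G], so that complexities are
    finite. *)
Lemma built_thick G : thick (fun X => exists ks, built G ks X).
Proof.
have bshift X : (exists ks, built G ks X) <-> (exists ks, built G ks (shift D X)).
  split=> -[ks bX]; first by eexists; apply: (@built_shiftz G 1 ks X bX).
  exists [seq -1 + k | k <- ks].
  apply: built_retract (built_shiftz (-1) bX); apply: isom_retract.
  exact/isom_sym/isom_unshiftK.
split=> //.
- split=> [X Y XY [ks bX]|X X0|X Y B bB [ks bX] [ls bY]].
  + by exists ks; apply: built_retract bX; apply/isom_retract/isom_sym.
  + by exists [::]; apply: built_zero.
  + by exists (ls ++ ks); apply: built_tri bX bY (tri_biprod bB).
- move=> X Y Z f g h d /bshift[ks bX] [ls bY]; exists (ks ++ ls).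
  by apply: built_tri bY bX (tri_rot _); exists f, g, h.
- move=> X Y B bB [ks bb]; exists ks; apply: built_retract bb.
  exact: biprod_retract bB.
Qed.

Lemma built_ex G F : split_generator G -> exists ks, built G ks F.
Proof.
move=> /(_ _ (built_thick G)); apply; exists [:: 0]; exact: built_refl.
Qed.

Lemma built_is_zero G ks F : is_zero G -> built G ks F -> is_zero F.
Proof.
move=> G0 [B rB fB]; apply: retract_zero rB _.
apply: filt_closed fB => //; last by move=> *; apply: tri_zero_mid; eassumption.
by move=> k Z _ e; apply: is_zero_isom (isom_sym e) _; apply: (proj1 (zero_shiftz _ _)).
Qed.

End Filtrations.

Section ExactFunctors.
Variables (K : fieldType) (D : tricat K) (Phi : functor D D).
Hypothesis exPhi : exact_functor Phi.
Implicit Types X Y Z G F : D.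

Lemma exact_isom_shift X : isom (Phi (shift D X)) (shift D (Phi X)).
Proof. by have [_ [eta [[_ ise] _]]] := exPhi; exists (eta X); apply: ise. Qed.

Lemma exact_tri X Y Z : tri X Y Z -> tri (Phi X) (Phi Y) (Phi Z).
Proof.
have [_ [eta [_ ed]]] := exPhi.
by move=> [f [g [h d]]]; do 3! eexists; apply: ed d.
Qed.

Lemma exact_isom_shiftz k X : isom (Phi (shiftz k X)) (shiftz k (Phi X)).
Proof.
apply: (isom_shiftz_updown (F := fun k => Phi (shiftz k X))) => [|j].
  exact: isom_refl.
apply: isom_trans (exact_isom_shift _); apply: fobj_isom; exact: isom_shiftzS.
Qed.

Lemma exact_zero X : is_zero X -> is_zero (Phi X).
Proof. exact: fobj_zero (proj1 exPhi) _. Qed.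

Lemma exact_built G ks F : built G ks F -> built (Phi G) ks (Phi F).
Proof.
move=> [B rB fB]; apply: built_retract (fobj_retract Phi rB) _.
elim: ks B {rB} fB => [|k ks IH] B.
  by move=> /filt_nilE/exact_zero; apply: built_zero.
move=> /filt_triE[Y [Z [/IH fY fZ t]]]; rewrite -cat1s.
apply: built_tri fY _ (exact_tri t); exists (Phi Z); first exact: retract_refl.
apply: filt_one; apply: isom_trans (fobj_isom Phi fZ) _.
exact: exact_isom_shiftz.
Qed.

Lemma fpow_built n G ks F : built G ks F -> built (fpow Phi n G) ks (fpow Phi n F).
Proof. by move=> b; elim: n => // n IH; apply: exact_built. Qed.

Lemma fpow_zero n X : is_zero X -> is_zero (fpow Phi n X).
Proof. by move=> X0; elim: n => // n IH; apply: exact_zero. Qed.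

Lemma fpowD (m n : nat) X : fpow Phi (m + n)%N X = fpow Phi m (fpow Phi n X).
Proof. by elim: m => // m IH; rewrite addSn /= IH. Qed.

End ExactFunctors.

(** * Bounded t-structures with finite heart *)

Section Levels.
Variables (K : fieldType) (D : tricat K).
Implicit Types X Y Z W : D.

(** The essential image [Sigma^k P] ([lev_shifted]). Indexing by the shift makes [tU k] equal to
    D^{<=-k} and [tV k] to D^{>=-k}, in step with the labels of filtrations. *)
Definition lev (P : D -> Prop) k X := P (shiftz (- k) X).

Section OnePredicate.
Variable P : D -> Prop.
Hypothesis Piso : forall X Y, isom X Y -> P X -> P Y.

Lemma lev_isom k X Y : isom X Y -> lev P k X -> lev P k Y.
Proof. by move=> /(isom_shiftz (- k)); apply: Piso. Qed.

Lemma lev_shiftz j k X : lev P (j + k) (shiftz j X) <-> lev P k X.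
Proof.
have e : isom (shiftz (- (j + k)) (shiftz j X)) (shiftz (- k) X).
  apply: isom_trans (isom_sym (isom_shiftzD _ _ _)) _.
  by rewrite opprD addrAC addNr add0r; apply: isom_refl.
by split; apply: Piso => //; apply: isom_sym.
Qed.

Lemma lev_shiftz0 k X : P X -> lev P k (shiftz k X).
Proof. by apply: Piso; apply/isom_sym/isom_shiftNz. Qed.

Lemma lev_shift k X : lev P (k + 1) (shift D X) <-> lev P k X.
Proof. by rewrite addrC; apply: (lev_shiftz 1). Qed.

Lemma lev_shifted k X : shifted k P X <-> lev P k X.
Proof. exact: shiftedP. Qed.

End OnePredicate.

Lemma dist_monol W X Y Z (f : Hom X Y) (g : Hom Y Z) h (u : Hom W X) :
  dist f g h -> hom0 (shift D W) Z -> f ∘ u = 0 -> u = 0.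
Proof.
move=> d WZ fu; apply: shift_inj.
have [|v <-] := dist_lifth (u := fmor (shift D) u) d.
  by rewrite -fmorM fu shift0.
by rewrite (WZ v) comp0r shift0.
Qed.

Lemma dist_epir W X Y Z (f : Hom X Y) (g : Hom Y Z) h (u : Hom Z W) :
  dist f g h -> hom0 (shift D X) W -> u ∘ g = 0 -> u = 0.
Proof.
move=> d XW ug; have [v <-] := dist_facth d ug.
by rewrite (XW v) comp0l.
Qed.

End Levels.

Section TStructure.
Variables (K : fieldType) (D : tricat K) (a : t_structure D).
Implicit Types X Y Z W E : D.

Definition tU := lev (tle a).
Definition tV := lev (tge a).
Definition tH X := tle a X /\ tge a X.

Lemma tle_isom X Y : isom X Y -> tle a X -> tle a Y.
Proof. by have [h _ _] := tle_additive a; apply: h. Qed.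

Lemma tge_isom X Y : isom X Y -> tge a X -> tge a Y.
Proof. by have [h _ _] := tge_additive a; apply: h. Qed.

Lemma tU_isom k X Y : isom X Y -> tU k X -> tU k Y.
Proof. exact: lev_isom tle_isom _ _ _. Qed.

Lemma tV_isom k X Y : isom X Y -> tV k X -> tV k Y.
Proof. exact: lev_isom tge_isom _ _ _. Qed.

Lemma tU_shift k X : tU k X -> tU (k + 1) (shift D X).
Proof. exact: (proj2 (lev_shift tle_isom _ _)). Qed.

Lemma tV_shift k X : tV k X -> tV (k + 1) (shift D X).
Proof. exact: (proj2 (lev_shift tge_isom _ _)). Qed.

Lemma tU_pred k X : tU (k + 1) X -> tU k X.
Proof.
move=> /tle_shift; apply: tle_isom.
apply: isom_trans (isom_sym (isom_shiftzS _ _)) _.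
by rewrite opprD subrK; apply: isom_refl.
Qed.

Lemma tV_succ k X : tV k X -> tV (k + 1) X.
Proof.
move=> /tge_unshift; apply: tge_isom.
apply: isom_trans (isom_sym (isom_shiftzD (-1) _ _)) _.
by rewrite opprD addrC; apply: isom_refl.
Qed.

Lemma tV_le k l X : k <= l -> tV k X -> tV l X.
Proof.
move=> kl; rewrite -[l](subrK k) addrC -[l - k]gez0_abs ?subr_ge0 // => Vk.
elim: `|_|%N => [|n IH]; first by rewrite addr0.
by rewrite -addn1 PoszD addrA; apply: tV_succ.
Qed.

Lemma tU_ge k l X : l <= k -> tU k X -> tU l X.
Proof.
move=> kl; rewrite -[k](subrK l) addrC -[k - l]gez0_abs ?subr_ge0 //.
elim: `|_|%N => [|n IH]; first by rewrite addr0.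
by rewrite -addn1 PoszD addrA => /tU_pred.
Qed.

Lemma tUV_hom0 k l X Y : l < k -> tU k X -> tV l Y -> hom0 X Y.
Proof.
move=> lk Uk Vl; apply: (proj2 (hom0_shiftz (- k) _ _)).
move=> f; apply: t_orth Uk _ f; apply: (proj2 (shiftedP _ _ tge_isom)).
have : tV (k - 1) Y by apply: tV_le Vl; rewrite lerBrDr lezD1.
apply: tge_isom; apply: isom_trans (isom_shiftzD _ _ _).
by rewrite opprB opprK; apply: isom_refl.
Qed.

Lemma t_dec k X : exists A B, [/\ tU (k + 1) A, tV k B & tri A X B].
Proof.
have [A [B [f [g [h [Ale Bge d]]]]]] := t_decomp a (shiftz (- (k + 1)) X).
exists (shiftz (k + 1) A), (shiftz (k + 1) B); split.
- exact: lev_shiftz0 tle_isom _ _ Ale.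
- move: Bge => /(shiftedP _ _ tge_isom) => Bge.
  apply: tge_isom Bge; apply: isom_trans (isom_shiftzD _ _ _).
  by rewrite addKr; apply: isom_refl.
have : tri A (shiftz (- (k + 1)) X) B by exists f, g, h.
move=> /(tri_shiftz (k + 1)); apply: tri_isom; try exact: isom_refl.
exact: isom_shiftzN.
Qed.

(** In the truncation triangle [g] is zero, while composition with [g] is injective on End(B)
    because [Sigma A] has no map to [B]; so [B] vanishes. Closure under extensions follows from this
    characterisation. *)
Lemma tU_char k X : (forall B, tV k B -> hom0 X B) -> tU (k + 1) X.
Proof.
move=> h; have [A [B [UA VB [f [g [w d]]]]]] := t_dec k X.
have B0 : is_zero B.
  apply/is_zeroP; apply: dist_epir d _ _; last by rewrite comp1m; apply: h.
  by apply: tUV_hom0 (tU_shift UA) VB; rewrite -addrA ltrDl.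
by apply: tU_isom UA; apply: (tri_zero_isom _ B0); exists f, g, w.
Qed.

Lemma tV_char k X : (forall A, tU (k + 1) A -> hom0 A X) -> tV k X.
Proof.
move=> h; have [A [B [UA VB [f [g [w d]]]]]] := t_dec k X.
have A0 : is_zero A.
  apply/is_zeroP; apply: dist_monol d _ _; last by rewrite compm1; apply: h.
  by apply: tUV_hom0 (tU_shift UA) VB; rewrite -addrA ltrDl.
apply: tV_isom VB; apply: isom_sym; apply: (tri_zero_isoml _ A0).
by exists f, g, w.
Qed.

Lemma tU_ext k X Y Z : tri X Y Z -> tU k X -> tU k Z -> tU k Y.
Proof.
move=> t; rewrite -[k](subrK 1) => UX UZ; apply: tU_char => B VB.
have lk : k - 1 < k - 1 + 1 by rewrite ltrDl.
exact: tri_hom0_midl t (tUV_hom0 lk UX VB) (tUV_hom0 lk UZ VB).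
Qed.

Lemma tV_ext k X Y Z : tri X Y Z -> tV k X -> tV k Z -> tV k Y.
Proof.
move=> t VX VZ; apply: tV_char => A UA.
have lk : k < k + 1 by rewrite ltrDl.
exact: tri_hom0_mid t (tUV_hom0 lk UA VX) (tUV_hom0 lk UA VZ).
Qed.

Lemma tU_zero k X : is_zero X -> tU k X.
Proof.
by move=> X0; rewrite -[k](subrK 1); apply: tU_char => B _; apply: hom0_zerol.
Qed.

(* The kernel of [f] in the heart is [H^{-1}(Z)]; if it vanishes then
   [Z = H^0(Z)]. *)
Lemma heart_kernel X Y Z (f : Hom X Y) (g : Hom Y Z) h :
  tH X -> tH Y -> dist f g h ->
  exists N (k : Hom N X), [/\ tH N, f ∘ k = 0,
    forall W (w : Hom W N), tH W -> k ∘ w = 0 -> w = 0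
    & is_zero N -> tH Z].
Proof.
move=> [UX VX] [UY VY] d; have t : tri X Y Z by exists f, g, h.
have UX' : tU 0 X by []. have UY' : tU 0 Y by [].
have VX' : tV 0 X by []. have VY' : tV 0 Y by [].
have UsX := tU_shift UX'; have VsX := tV_shift VX'.
have UZ : tU 0 Z by apply: tU_ext (tri_rot t) UY' (tU_pred UsX).
have VZ : tV 1 Z by apply: tV_ext (tri_rot t) (tV_succ VY') VsX.
(* Truncation separates [A], the shift of H^{-1}(Z), from [B], which is H^0(Z); the kernel is [A]
   shifted back, with the map to [X] induced by [h]. *)
have [A [B [UA VB t']]] := t_dec 0 Z.
have UB : tU 0 B.
  exact: tU_ext (tri_rot t') UZ (tU_pred (tU_pred (tU_shift UA))).
have VA : tV 1 A.
  apply: tV_char => W UW; apply: tri_hom0_left t' _ _.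
    exact: tUV_hom0 UW VZ.
  exact: tUV_hom0 (tU_shift UW) VB.
have [i [b [c d']]] := t'.
have eA := isom_shiftK A; have [e [e' [e'e ee']]] := eA.
have [k ek] := shift_full (h ∘ i ∘ e).
exists (unshift D A), k; split.
- by split; [apply: (proj1 (lev_shift tle_isom 0 _))|
    apply: (proj1 (lev_shift tge_isom 0 _))]; [apply: tU_isom UA|apply: tV_isom VA];
    apply: isom_sym.
- by apply: shift_inj; rewrite fmorM ek shift0 !compA (dist_fh d) !comp0l.
- move=> W w [UW VW] kw.
  have UsW : tU 1 (shift D W) by apply: (@tU_shift 0).
  have e1 : h ∘ (i ∘ (e ∘ fmor (shift D) w)) = 0.
    by rewrite !compA -ek -fmorM kw shift0.
  have [v ev] := dist_liftg d e1.
  have v0 : v = 0 by apply: (tUV_hom0 (k := 1) (l := 0)).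
  have e2 : e ∘ fmor (shift D) w = 0.
    apply: dist_monol d' _ _; last by rewrite -ev v0 comp0r.
    exact: tUV_hom0 (tU_shift UsW) VB.
  apply: shift_inj; rewrite shift0.
  by rewrite -[LHS]comp1m -e'e -compA e2 comp0r.
- move=> N0; split=> //; apply: tge_isom (VB : tge a B).
  apply/isom_sym/(tri_zero_isoml t'); apply: is_zero_isom eA _.
  exact: (proj1 (zero_shift _)).
Qed.

Lemma heart_zero (X : heart a) : is_zero X <-> is_zero (sval X).
Proof. by split=> /is_zeroP h; apply/is_zeroP. Qed.

Lemma heart_kernel_mono (X Y : heart a) Z (f : Hom X Y)
    (g : Hom (sval Y) Z) (h : Hom Z (shift D (sval X))) :
  dist (f : @Hom K D (sval X) (sval Y)) g h ->
  exists (N : heart a) (k : Hom N X),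
    [/\ is_mono k, f ∘ k = 0 & is_zero N -> tH Z].
Proof.
move=> d; have [N [k [HN fk mk N0]]] := heart_kernel (svalP X) (svalP Y) d.
exists (exist tH N HN), k; split=> //; last by move=> /heart_zero.
move=> W u v /= kuv; apply/eqP; rewrite -subr_eq0; apply/eqP.
apply: (mk (sval W)); first exact: svalP.
by rewrite compBr; apply/eqP; rewrite subr_eq0; apply/eqP.
Qed.

(** With [heart_mono_tri]: monomorphisms of the heart are the maps whose cone lies in the heart,
    which translates subobjects into triangles. *)
Lemma heart_mono_cone (X Y : heart a) Z (f : Hom X Y)
    (g : Hom (sval Y) Z) (h : Hom Z (shift D (sval X))) :
  is_mono f -> dist (f : @Hom K D (sval X) (sval Y)) g h -> tH Z.
Proof.
move=> mf /heart_kernel_mono[N [k [mk fk]]]; apply.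
apply/is_zeroP; apply: mk; rewrite compm1 comp0r.
by apply: mf; rewrite fk comp0r.
Qed.

Lemma tH_shift_hom0 X Y : tH X -> tH Y -> hom0 (shift D X) Y.
Proof.
move=> [UX _] [_ VY]; have UX' : tU 0 X by [].
exact: tUV_hom0 (tU_shift UX') (VY : tV 0 Y).
Qed.

Lemma heart_mono_tri (X Y : heart a) Z (f : Hom X Y)
    (g : Hom (sval Y) Z) (h : Hom Z (shift D (sval X))) :
  tH Z -> dist (f : @Hom K D (sval X) (sval Y)) g h -> is_mono f.
Proof.
move=> HZ d W u v /= fuv; apply/eqP; rewrite -subr_eq0; apply/eqP.
apply: dist_monol d (tH_shift_hom0 (svalP W) HZ) _.
by rewrite compBr; apply/eqP; rewrite subr_eq0; apply/eqP.
Qed.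

Lemma heart_schur (S T : heart a) (f : Hom S T) :
  simple S -> simple T -> f = 0 \/ is_iso f.
Proof.
move=> [S0 Ss] [T0 Ts].
have [Z [g [h d]]] := dist_cone (f : @Hom K D (sval S) (sval T)).
have [N [k [mk fk N0]]] := heart_kernel_mono d.
have [/N0 HZ|[k' [_ kk']]] := Ss _ _ mk.
  by have [|] := Ts _ _ (heart_mono_tri HZ d); [move=> /S0|right].
by left; rewrite -[f]compm1 -kk' compA fk comp0l.
Qed.

Definition simp k Z := exists2 S : heart a, simple S & isom Z (shiftz k (sval S)).

Lemma simp_shiftz j k Z : simp k Z -> simp (j + k) (shiftz j Z).
Proof.
move=> [S sS eS]; exists S => //; apply: isom_trans (isom_shiftz j eS) _.
exact/isom_sym/isom_shiftzD.
Qed.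

Lemma simp_tU k Z : simp k Z -> tU k Z.
Proof.
move=> [S _ eS]; apply: tU_isom (isom_sym eS) _.
by apply: (lev_shiftz0 tle_isom); have [] := svalP S.
Qed.

Lemma simp_tV k Z : simp k Z -> tV k Z.
Proof.
move=> [S _ eS]; apply: tV_isom (isom_sym eS) _.
by apply: (lev_shiftz0 tge_isom); have [] := svalP S.
Qed.

Lemma simp_nonzero k Z : simp k Z -> ~ is_zero Z.
Proof.
move=> [S [S0 _] eS] /(is_zero_isom eS) Z0; apply/S0/heart_zero.
exact: (proj2 (zero_shiftz k _)).
Qed.

Lemma schur_isom X Y X' Y' : isom X X' -> isom Y Y' ->
  (forall f : Hom X Y, f = 0 \/ is_iso f) ->
  forall f : Hom X' Y', f = 0 \/ is_iso f.
Proof.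
move=> [u [u' [u'u uu']]] [v [v' [v'v vv']]] h f.
have ef : f = v ∘ (v' ∘ f ∘ u) ∘ u'.
  by rewrite !compA vv' comp1m -compA uu' compm1.
rewrite ef; have [->|i] := h (v' ∘ f ∘ u); first by left; rewrite comp0r comp0l.
right; apply: is_iso_comp; last by exists u.
by apply: is_iso_comp i; exists v'.
Qed.

Lemma simp_schur k Z Z' (f : Hom Z Z') : simp k Z -> simp k Z' ->
  f = 0 \/ is_iso f.
Proof.
move=> [S sS eS] [T sT eT].
apply: (schur_isom (isom_sym eS) (isom_sym eT)).
apply: (proj1 (shiftz_updown2
  (P := fun X Y => forall f : Hom X Y, f = 0 \/ is_iso f) k _ _ _ _)).
- exact: schur_isom.
- move=> X Y; split=> h u.
    have [u0 <-] := shift_full u; have [->|] := h u0; first by left; rewrite shift0.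
    by right; apply: fmor_iso.
  have [e|i] := h (fmor (shift D) u); last by right; apply: shift_iso_reflect.
  by left; apply: shift_inj; rewrite shift0.
- by move=> u; apply: heart_schur.
Qed.

(** The cokernel in the heart and the cone of a monomorphism both classify the maps killed by it,
    and are therefore isomorphic; a composition series becomes a chain of triangles. *)
Lemma comp_series_filt n (X : heart a) :
  comp_series n X -> filt simp (nseq n 0) (sval X).
Proof.
elim=> {n X} [X /heart_zero X0|n Y X S f g _ fY mf [gf ug] sS].
  exact: filt_nil.
have [Z [g0 [h0 d]]] := dist_cone (f : @Hom K D (sval Y) (sval X)).
have HZ := heart_mono_cone mf d.
have [h0' [eh0 _]] := ug (exist tH Z HZ) g0 (dist_gf d).
pose g' : @Hom K D (sval X) (sval S) := g.
pose h' : @Hom K D (sval S) Z := h0'.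
have eh : h' ∘ g' = g0 by exact: eh0.
have [v ev] := dist_factg (u := g') d gf.
have vh' : v ∘ h' = idm (sval S).
  have [w [_ wu]] := ug S g gf.
  have <- : w = v ∘ h' by apply: wu; rewrite -[LHS]compA -[RHS]ev -eh.
  by apply: wu; apply: (@comp1m K (heart a)).
have h'v : h' ∘ v = idm Z.
  apply/eqP; rewrite -subr_eq0; apply/eqP.
  apply: dist_epir d (tH_shift_hom0 (svalP Y) HZ) _.
  by rewrite compBl comp1m -compA ev eh subrr.
apply: (filt_cons (k := 0) fY _ d).
by exists S => //; exists v, h'.
Qed.

End TStructure.

(** * Jordan-Hoelder theory for filtrations by shifted simple objects *)

Section SimpleFiltrations.
Variables (K : fieldType) (D : tricat K) (a : t_structure D).
Implicit Types X Y Z W E F : D.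

Lemma filt_tU k ks X : filt (simp a) ks X -> all (>= k) ks -> tU a k X.
Proof.
move=> fX /allP kks; apply: filt_closed fX.
- by move=> *; apply: tU_zero.
- by move=> l Z /kks kl /simp_tU; apply: tU_ge.
- by move=> *; apply: tU_ext; eassumption.
Qed.

Lemma le_sortedE (k : int) ks : sorted <=%R (k :: ks) = all (>= k) ks && sorted <=%R ks.
Proof. exact: (path_sortedE le_trans). Qed.

(** The inner part lies in levels at least [k], so its shift has no map to [Z]; a zero [g] would
    then force [Z] to be zero. *)
Lemma outer_simp_neq0 k ks Y X Z (f : Hom Y X) (g : Hom X Z) h :
  all (>= k) ks -> filt (simp a) ks Y -> simp a k Z -> dist f g h -> g <> 0.
Proof.
move=> kks fY sZ d g0; apply: (simp_nonzero sZ); apply/is_zeroP.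
apply: dist_epir d _ _; last by rewrite comp1m.
apply: tUV_hom0 (tU_shift (filt_tU fY kks)) (simp_tV sZ).
by rewrite ltrDl.
Qed.

Lemma simp_hom_neq0 k l Z W (f : Hom Z W) : k <= l -> simp a l Z -> simp a k W ->
  f <> 0 -> k = l /\ is_iso f.
Proof.
rewrite le_eqVlt => /predU1P[<-|kl] sZ sW f0.
  by split=> //; have [|//] := simp_schur f sZ sW; move=> /f0.
by case: f0; apply: tUV_hom0 kl (simp_tU sZ) (simp_tV sW) f.
Qed.

(** The exchange step. Either [g] vanishes on the inner part [Y1] and, by Schur, identifies the
    outer simple factor with [S], or induction applies to [Y1] and the octahedral axiom puts the
    outer factor back. *)
Lemma filt_remove k ks X Y S (y : Hom Y X) (g : Hom X S) h :
  sorted <=%R ks -> filt (simp a) ks X -> all (>= k) ks -> simp a k S ->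
  dist y g h -> g <> 0 ->
  exists ks', [/\ sorted <=%R ks', filt (simp a) ks' Y & perm_eq ks (k :: ks')].
Proof.
elim: ks X Y y g h => [|k1 ks IH] X Y y g h.
  by move=> _ /filt_nilE X0 _ _ _ []; apply: hom0_zerol.
rewrite le_sortedE => /andP[kks sks] fX /= /andP[kk1 kks'] sS d g0.
have [Y1 [S1 [f1 [g1 [h1 [fY1 sS1 d1]]]]]] := filt_consE fX.
have [gf0|/eqP gf0] := eqVneq (g ∘ f1) 0.
  have [c cg] := dist_factg d1 gf0.
  have c0 : c <> 0 by move=> c0; apply: g0; rewrite -cg c0 comp0l.
  have [kk isoc] := simp_hom_neq0 kk1 sS1 sS c0.
  have [|b [isob _]] := cocone_uniq d1 d (is_iso_id X) isoc.
    by rewrite cg compm1.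
  exists ks; split=> //; last by rewrite kk.
  by apply: filt_isom fY1; exists b.
have [W [w [h' d']]] := cocone_ex (g ∘ f1).
have [ks' [sks' fW p]] := IH _ _ _ _ _ sks fY1 kks' sS d' gf0.
have [u [k' [d'' _]]] := oct_mid d1 d d'.
exists (k1 :: ks'); split.
- rewrite le_sortedE sks' andbT; apply/allP => x xks'.
  by apply: (allP kks); rewrite (perm_mem p) inE xks' orbT.
- exact: filt_cons fW sS1 d''.
- rewrite -(cat1s k) -(cat1s k1 ks') perm_sym perm_catCA /= perm_cons.
  by rewrite perm_sym.
Qed.

Definition head_le (ls ls' : seq int) : bool :=
  match ls, ls' with
  | l :: _, l' :: _ => l <= l' | _, [::] => true | [::], _ :: _ => false
  end.

(** By symmetry [F] has the smallest outer label. Projecting [X] to [F] and on to its outer simple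
    factor is a nonzero map to a simple object of lowest degree; [filt_remove] strips it off, and
    the fibre is the biproduct of [F1] and [F']. *)
Lemma filt_biprod_perm (ls ls' ks : seq int) F F' X : is_biprod F F' X ->
  sorted <=%R ls -> filt (simp a) ls F -> sorted <=%R ls' -> filt (simp a) ls' F' ->
  sorted <=%R ks -> filt (simp a) ks X -> perm_eq ks (ls ++ ls').
Proof.
have [n] := ubnP (size ls + size ls')%N.
elim: n ls ls' ks F F' X => // n IH ls ls' ks F F' X.
wlog: ls ls' F F' / head_le ls ls'.
  move=> H sz bX sls fF sls' fF' sks fX.
  have [c|c] : head_le ls ls' \/ head_le ls' ls.
  - by case: ls ls' {sz sls sls' fF fF'} => [|l ls] [|l' ls'] /=; [left|right|left|apply/orP/le_total].
  - exact: H c sz bX sls fF sls' fF' sks fX.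
  rewrite perm_sym perm_catC perm_sym.
  by apply: (H ls' ls F' F c _ (biprod_sym bX)) => //; rewrite addnC.
case: ls => [|l ls].
  case: ls' => // _ _ bX _ /filt_nilE F0 _ /filt_nilE F'0 sks fX.
  have X0 : is_zero X by apply: tri_zero_mid (tri_biprod bX) F0 F'0.
  case: ks sks fX => // k ks; rewrite le_sortedE => /andP[kks _].
  move=> /filt_consE[Y [Z [f [g [h [fY sZ d]]]]]].
  by case: (outer_simp_neq0 kks fY sZ d); apply: hom0_zerol.
move=> c sz bX; rewrite le_sortedE => /andP[lls sls] fF sls' fF' sks fX.
have lls' : all (>= l) ls'.
  case: ls' c sls' {sz fF'} => //= l' ls' ll'.
  rewrite (path_sortedE le_trans) => /andP[l'ls' _]; rewrite ll' /=.
  by apply: sub_all l'ls' => x; apply: le_trans.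
have lks : all (>= l) ks.
  have UX : tU a l X.
    apply: tU_ext (tri_biprod bX) (filt_tU fF _) (filt_tU fF' lls').
    by rewrite /= lexx lls.
  case: ks sks fX => // k ks; rewrite le_sortedE => /andP[kks _].
  move=> /filt_consE[Y [Z [f [g [h [fY sZ d]]]]]].
  have lk : l <= k.
    rewrite leNgt; apply/negP => kl; apply: (outer_simp_neq0 kks fY sZ d).
    exact: tUV_hom0 kl UX (simp_tV sZ) g.
  by rewrite /= lk; apply: sub_all kks => x; apply: le_trans.
have [F1 [S [f1 [g1 [h1 [fF1 sS d1]]]]]] := filt_consE fF.
have [i1 [i2 [p1 [p2 e]]]] := bX; have [pi _ _ _ _] := e.
have [Y [y [h d]]] := cocone_ex (g1 ∘ p1).
have g0 : g1 ∘ p1 <> 0.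
  move=> /(congr1 (fun u => u ∘ i1)); rewrite -compA pi compm1 comp0l.
  exact: outer_simp_neq0 lls fF1 sS d1.
have [ks' [sks' fY p]] := filt_remove sks fX lks sS d g0.
apply: (perm_trans p); rewrite perm_cons.
exact: IH (biprod_fibre d1 e d) sls fF1 sls' fF' sks' fY.
Qed.

Lemma filt_simp_uniq ks ls X :
  sorted <=%R ks -> filt (simp a) ks X -> sorted <=%R ls -> filt (simp a) ls X ->
  perm_eq ks ls.
Proof.
move=> sks fks sls fls; have [[Z Z0] _] := tcat_additive D.
rewrite -[ls]cats0; apply: (filt_biprod_perm (biprod0 X Z0)) => //.
exact: filt_nil.
Qed.

(** For labels [k < l] in the wrong order the connecting map goes from level [l] to level [k + 1].
    It vanishes if [l > k + 1]; if [l = k + 1] it is zero, and the extension splits, or invertible,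
    and the extension is a zero object. *)
Lemma filt_simp_sort ks X : filt (simp a) ks X -> exists ms rest,
  [/\ sorted <=%R ms, filt (simp a) ms X & perm_eq (ms ++ rest) ks].
Proof.
apply: filt_sort; [exact: le_total|exact: le_trans|].
move=> k l A W B sA sB; rewrite -ltNge => kl t.
have [f [g [h d]]] := t.
have [l1|l1] := eqVneq l (k + 1).
  have sA' : simp a l (shift D A).
    by rewrite l1 addrC; apply: (simp_shiftz 1 sA).
  have [h0|isoh] := simp_schur h sB sA'.
    right; rewrite h0 in d.
    exact: tri_biprod (biprod_sym (dist_split_biprod d)).
  left; have [h' [h'h hh']] := isoh.
  have g0 : g = 0 by rewrite -[g]comp1m -h'h -compA (dist_hg d) comp0r.
  have f0 : f = 0.
    apply: shift_inj; rewrite shift0 -[LHS]compm1 -hh' compA.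
    by rewrite (dist_fh d) comp0l.
  apply/is_zeroP; have [|v <-] := dist_liftf (u := idm W) d.
    by rewrite g0 comp0l.
  by rewrite f0 comp0l.
right; apply: tri_swap t _.
apply: tUV_hom0 _ (simp_tU sB) (tV_shift (simp_tV sA)).
by rewrite lt_neqAle eq_sym l1 lezD1.
Qed.

Hypothesis bnd : t_bounded a.

(** Induction on the amplitude: truncation peels off the lowest level as outermost factor. The lower
    bound on the labels is carried along to keep them strictly decreasing. *)
Lemma t_filtration_ex E : exists fs : seq (int * heart a), t_filtration E fs.
Proof.
have [[k /(lev_shifted (@tle_isom _ _ a)) Uk] [l /(lev_shifted (@tge_isom _ _ a)) Vl]] := bnd E.
suff [fs []] : exists fs : seq (int * heart a), t_filtration E fs /\ all (>= k) [seq p.1 | p <- fs].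
  by exists fs.
have {Vl} : exists n : nat, tV a (k + n%:Z) E.
  exists `|l - k|%N; apply: tV_le Vl.
  by lia.
move: Uk; rewrite -/(tU a k E) => + [n]; elim: n k E => [|n IH] k X Uk.
  rewrite addr0 => Vk.
  have HX : tH a (shiftz (- k) X) by [].
  exists [:: (k, exist (tH a) _ HX)]; split; last by rewrite /= lexx.
  split=> //=; have [[Z Z0] _] := tcat_additive D.
  apply: (@filtration_tri _ _ [::] Z); first exact: filtration0.
  by apply: tri_isom (tri_zerol X Z0); [apply: isom_refl..|apply: isom_sym; apply: isom_shiftzN].
move=> Vk; have [A [B [UA VB t]]] := t_dec a k X.
have VA : tV a (k + 1 + n%:Z) A.
  apply: tV_char => W UW; apply: tri_hom0_left t _ _.
    by apply: tUV_hom0 UW Vk; lia.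
  by apply: tUV_hom0 (tU_shift UW) VB; lia.
have UB : tU a k B.
  apply: tU_ext (tri_rot t) Uk (tU_ge _ (tU_shift UA)); lia.
have [fs [[ffs sfs] kfs]] := IH _ _ UA VA.
have HB : tH a (shiftz (- k) B) by [].
exists (rcons fs (k, exist (tH a) _ HB)); split; last first.
  rewrite map_rcons all_rcons /= lexx /=.
  by apply: sub_all kfs => x /=; apply: le_trans; rewrite lerDl.
split.
  rewrite map_rcons; apply: filtration_tri ffs _.
  by apply: tri_isom t; [apply: isom_refl..|apply: isom_sym; apply: isom_shiftzN].
rewrite map_rcons sorted_pairwise; last by move=> x y z /= yx zy; apply: lt_trans zy yx.
rewrite pairwise_rcons -sorted_pairwise; last by move=> x y z /= yx zy; apply: lt_trans zy yx.
rewrite sfs andbT; apply: sub_all kfs => x /=; lia.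
Qed.

End SimpleFiltrations.

(** * Weights of lists of shifts *)

Section Weights.
Variables (R : realType) (t : R).
Implicit Types ks ls : seq int.

Definition weight ks : R := \sum_(k <- ks) expR (k%:~R * t).

Lemma weight_nil : weight [::] = 0.
Proof. exact: big_nil. Qed.

Lemma weight_cons k ks : weight (k :: ks) = expR (k%:~R * t) + weight ks.
Proof. exact: big_cons. Qed.

Lemma weight_cat ks ls : weight (ks ++ ls) = weight ks + weight ls.
Proof. exact: big_cat. Qed.

Lemma weight_ge0 ks : 0 <= weight ks.
Proof. by apply: sumr_ge0 => *; apply: expR_ge0. Qed.

Lemma weight_gt0 ks : ks != [::] -> 0 < weight ks.
Proof.
by case: ks => // k ks _; rewrite weight_cons ltr_pwDl ?expR_gt0 ?weight_ge0.
Qed.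

Lemma weight_perm ks ls : perm_eq ks ls -> weight ks = weight ls.
Proof. exact: perm_big. Qed.

Lemma weight_sub ks ls rest : perm_eq (ks ++ rest) ls -> weight ks <= weight ls.
Proof. by move/weight_perm <-; rewrite weight_cat lerDl weight_ge0. Qed.

Lemma weight_shift j ks : weight [seq j + k | k <- ks] = expR (j%:~R * t) * weight ks.
Proof.
rewrite /weight big_map mulr_sumr; apply: eq_bigr => k _.
by rewrite intrD mulrDl expRD.
Qed.

Lemma weight_allpairs ks ls :
  weight [seq l + k | l <- ls, k <- ks] = weight ks * weight ls.
Proof.
elim: ls => [|l ls IH]; first by rewrite weight_nil mulr0.
by rewrite allpairs_cons weight_cat weight_shift weight_cons IH mulrDr mulrC.
Qed.

Lemma weight_nseq n k : weight (nseq n k) = n%:R * expR (k%:~R * t).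
Proof. by rewrite /weight big_nseq iter_addr_0 mulr_natl. Qed.

Lemma weight_flatten T (F : T -> seq int) s :
  weight (flatten [seq F p | p <- s]) = \sum_(p <- s) weight (F p).
Proof.
elim: s => [|p s IH]; first by rewrite big_nil weight_nil.
by rewrite /= weight_cat big_cons IH.
Qed.

End Weights.

Section BuiltWeight.
Variables (R : realType) (t : R) (K : fieldType) (D : tricat K).
Implicit Types X Y Z G F : D.

(** Each of the finitely many representatives [S i] is built from [G] by a list [c i], which is
    substituted for every factor of that class; the sum of the weights of these lists bounds each of
    them. *)
Lemma built_weight (fac : int -> D -> Prop) n (S : 'I_n -> D) G :
  (forall k Z, fac k Z -> exists i, isom Z (shiftz k (S i))) ->
  split_generator G ->
  exists2 C : R, 0 <= C & forall ks X, filt fac ks X ->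
    exists2 ls, built G ls X & weight t ls <= C * weight t ks.
Proof.
move=> facS genG.
have [c bc] := choice (fun i => built_ex (S i) genG).
exists (\sum_i weight t (c i)); first by apply: sumr_ge0 => *; apply: weight_ge0.
elim=> [|k ks IH] X.
  move=> /filt_nilE X0; exists [::]; first exact: built_zero.
  by rewrite weight_nil mulr0.
move=> /filt_triE[Y [Z [/IH[ls bY lsw] /facS[i eZ] tr]]].
exists ([seq k + j | j <- c i] ++ ls).
  by apply: built_tri bY _ tr; apply: built_retract (isom_retract eZ) (built_shiftz _ _).
rewrite weight_cat weight_shift weight_cons mulrDr lerD // mulrC ler_wpM2r ?expR_ge0 //.
by rewrite (bigD1 i) //= lerDl sumr_ge0 // => *; apply: weight_ge0.
Qed.

Lemma weightless_zero (fac : int -> D -> Prop) ks X :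
  filt fac ks X -> ~ is_zero X -> 0 < weight t ks.
Proof.
move=> fX X0; apply: weight_gt0; apply/eqP => ks0; apply: X0.
by move: fX; rewrite ks0 => /filt_nilE.
Qed.

End BuiltWeight.

(** * Comparison of [hat_delta] with constructions from a generator *)

Section HatDelta.
Variables (R : realType) (t : R) (K : fieldType) (D : tricat K).
Variable a : t_structure D.
Hypotheses (bnd : t_bounded a) (fin : finite_length_cat (heart a)).
Implicit Types X Y Z G F E : D.

Lemma lambda_filt k (X : heart a) :
  filt (simp a) (nseq (lambda X) k) (shiftz k (sval X)).
Proof.
have cX : comp_series (lambda X) X by apply: (xgetPex 0%N) (fin.1 X).
have := filt_shiftz (j := k) (fun l => simp_shiftz k (k := l)) (comp_series_filt cX).
by rewrite map_nseq addr0.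
Qed.

Lemma t_filtration_filt E (fs : seq (int * heart a)) : t_filtration E fs ->
  exists ks, [/\ sorted <=%R ks, filt (simp a) ks E
    & \sum_(p <- fs) (lambda p.2)%:R * expR (p.1%:~R * t) = weight t ks].
Proof.
move=> [ff sf]; exists (flatten [seq nseq (lambda p.2) p.1 | p <- rev fs]); split.
- move: sf; elim/last_ind: fs {ff} => // fs p IH.
  rewrite map_rcons sorted_pairwise; last by move=> x y z /= yx zy; apply: lt_trans zy yx.
  rewrite pairwise_rcons -sorted_pairwise; last by move=> x y z /= yx zy; apply: lt_trans zy yx.
  move=> /andP[pfs /IH]; rewrite rev_rcons /= !(sorted_pairwise le_trans).
  rewrite pairwise_cat => ->; rewrite andbT; apply/andP; split.
    rewrite /allrel all_nseq /=; apply/orP; right.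
    elim/last_ind: fs pfs {IH} => // fs q IH.
    rewrite map_rcons all_rcons rev_rcons /= all_cat => /andP[pq /IH ->].
    by rewrite andbT all_nseq ltW ?orbT.
  by elim: (lambda _) => //= m ->; rewrite andbT all_nseq lexx orbT.
- by apply: filtration_filt ff => p; apply: lambda_filt.
- rewrite weight_flatten big_rev.
  by apply: eq_bigr => p _; rewrite weight_nseq.
Qed.

Lemma hat_deltaP E :
  exists ks, [/\ sorted <=%R ks, filt (simp a) ks E & hat_delta a t E = weight t ks].
Proof.
have /(xgetPex 0%R)[fs [tfs]] : exists s : R, exists fs : seq (int * heart a),
    t_filtration E fs /\ s = \sum_(p <- fs) (lambda p.2)%:R * expR (p.1%:~R * t).
  by have [fs tfs] := t_filtration_ex bnd E; do 2! eexists; split; [exact: tfs|].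
rewrite -/(hat_delta a t E) => ->.
exact: t_filtration_filt.
Qed.

(** The simple factors of [G] refine the filtration of [B]. Sorting it and then dropping the factors
    of the complement [F'] can only lower the weight. *)
Lemma hat_delta_built G ls F : built G ls F ->
  hat_delta a t F <= hat_delta a t G * weight t ls.
Proof.
move=> [B /retract_summand[F' bB] fB].
have [ksF [sF fF ->]] := hat_deltaP F; have [ksG [_ fG ->]] := hat_deltaP G.
have [ksF' [sF' fF' _]] := hat_deltaP F'.
have fB' := filt_built (fun j k Z => @simp_shiftz _ _ a j k Z) fG fB.
have [ms [rest [sms fms p]]] := filt_simp_sort fB'.
rewrite -weight_allpairs; apply: le_trans (weight_sub t p).
rewrite (weight_perm t (filt_biprod_perm bB sF fF sF' fF' sms fms)).
by rewrite weight_cat lerDl weight_ge0.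
Qed.

Lemma built_hat_delta G : split_generator G ->
  exists2 C : R, 0 <= C & forall F,
    exists2 ls, built G ls F & weight t ls <= C * hat_delta a t F.
Proof.
move=> genG; have [n [S allS]] := fin.2.
have [|C C0 HC] := @built_weight R t K D (simp a) n (fun i => sval (S i)) G _ genG.
  move=> k Z [T sT eT]; have [i [f isof]] := allS T sT.
  exists i; apply: isom_trans eT _; apply: isom_shiftz.
  by exists f.
exists C => // F; have [ks [_ fF ->]] := hat_deltaP F.
exact: HC fF.
Qed.

Lemma hat_delta_gt0 F : ~ is_zero F -> 0 < hat_delta a t F.
Proof.
by have [ks [_ fF ->]] := hat_deltaP F; apply: weightless_zero fF.
Qed.

Lemma hat_delta_zero F : is_zero F -> hat_delta a t F = 0.
Proof.
move=> F0; have [ks [sks fF ->]] := hat_deltaP F.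
have := filt_simp_uniq sks fF (isT : sorted <=%R [::]) (filt_nil _ F0).
by move=> /perm_nilP ->; rewrite weight_nil.
Qed.

End HatDelta.

(** * Bounded co-t-structures with finite co-heart *)

Section LocalObjects.
Variables (K : fieldType) (C : lincat K).
Implicit Types X Y Z : C.

Lemma local_isom X Y : isom X Y -> local_end X -> local_end Y.
Proof.
move=> XY [X0 loc]; split; first by move=> /(is_zero_isom (isom_sym XY)).
have [u [u' [u'u uu']]] := XY.
have conj (f : Hom Y Y) : is_iso f <-> is_iso (u' ∘ f ∘ u).
  have isou : is_iso u by exists u'.
  have isou' : is_iso u' by exists u.
  split=> i; first by do 2?[apply: is_iso_comp].
  have -> : f = u ∘ (u' ∘ f ∘ u) ∘ u'.
    by rewrite !compA uu' comp1m -compA uu' compm1.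
  by do 2?[apply: is_iso_comp].
move=> f g /conj nf /conj ng /conj; rewrite compDr compDl.
exact: loc.
Qed.

(** The two idempotents of a decomposition sum to the identity, so one of them is invertible, which
    kills the other summand. *)
Lemma local_indec X : local_end X -> indecomposable X.
Proof.
move=> [X0 loc]; split=> // Y Z [i1 [i2 [p1 [p2 [e1 e2 e3 e4 e5]]]]].
have [iso1|n1] := pselect (is_iso (i1 ∘ p1)).
  right; have [g [g1 _]] := iso1; apply/is_zeroP.
  by rewrite -e2 -[i2]comp1m -g1 -(compA g) -(compA i1) e3 !comp0r.
have [iso2|n2] := pselect (is_iso (i2 ∘ p2)).
  left; have [g [g1 _]] := iso2; apply/is_zeroP.
  by rewrite -e1 -[i1]comp1m -g1 -(compA g) -(compA i2) e4 !comp0r.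
by case: (loc _ _ n1 n2); rewrite e5; apply: is_iso_id.
Qed.

(* [u (r u)^-1 r] is a nonzero idempotent, hence is the identity. *)
Lemma local_comp_iso X Y (r : Hom X Y) (u : Hom Y X) :
  local_end X -> ~ is_zero Y -> is_iso (r ∘ u) -> is_iso r.
Proof.
move=> [X0 loc] Y0 [g [g1 g2]].
pose e := u ∘ g ∘ r.
have ee : e ∘ e = e.
  by rewrite /e -(compA (u ∘ g) r) (compA r) (compA r) g2 comp1m.
have re : r ∘ e = r by rewrite /e !compA g2 comp1m.
have [isoe|ne] := pselect (is_iso e).
  have e1 : e = idm X.
    by have [v [ve _]] := isoe; rewrite -[e]comp1m -ve -compA ee.
  by exists (u ∘ g); split; rewrite ?compA // -e1.
have [[v [_ ev]]|ne'] := pselect (is_iso (idm X - e)).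
  case: Y0; apply/is_zeroP; rewrite -g2 -compA -[r]compm1 -ev.
  by rewrite (compA r) compBr compm1 re subrr !comp0l.
by case: (loc _ _ ne ne'); rewrite addrC subrK; apply: is_iso_id.
Qed.

End LocalObjects.

Section DirectSums.
Variables (K : fieldType) (D : tricat K).
Implicit Types X Y Z : D.

Lemma local_shift X : local_end X <-> local_end (shift D X).
Proof.
have iso_sh (f : Hom X X) : is_iso f <-> is_iso (fmor (shift D) f).
  by split; [apply: fmor_iso|apply: shift_iso_reflect].
split=> -[X0 loc]; split.
- by move=> /(proj2 (zero_shift X)).
- move=> f g; have [f' <-] := shift_full f; have [g' <-] := shift_full g.
  rewrite -shift_additive => /iso_sh nf /iso_sh ng /iso_sh; exact: loc.
- by move=> /(proj1 (zero_shift X)).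
- move=> f g /iso_sh nf /iso_sh ng /iso_sh; rewrite shift_additive; exact: loc.
Qed.

Lemma local_shiftz k X : local_end X <-> local_end (shiftz k X).
Proof. by apply: shiftz_updown; [exact: local_isom|exact: local_shift]. Qed.

Lemma dirsum0 (X : 'I_0 -> D) B : is_dirsum X B -> is_zero B.
Proof. by move=> [i [p [_ _]]]; rewrite big_ord0 => e; apply/is_zeroP. Qed.

(** [B'] is the fibre of the last projection. The other inclusions and projections pass through it
    because the complementary idempotent [f r] leaves their composites unchanged. *)
Lemma dirsum_split n (X : 'I_n.+1 -> D) B : is_dirsum X B ->
  exists2 B', is_biprod B' (X ord_max) B &
    is_dirsum (fun i => X (widen_ord (leqnSn n) i)) B'.
Proof.
move=> [i [p [pi pi0 sum]]].
have [B' [f [h d]]] := cocone_ex (p ord_max).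
have h0 := dist_section d (pi ord_max); rewrite h0 in d.
exists B'; first exact: dist_split_biprod d.
have [r [rf _ e]] := dist_split_sec d (pi ord_max).
have neq (j : 'I_n) : ord_max != widen_ord (leqnSn n) j.
  by rewrite -val_eqE /= gtn_eqF.
exists (fun j => r ∘ i (widen_ord (leqnSn n) j)).
exists (fun j => p (widen_ord (leqnSn n) j) ∘ f).
have key j k : p (widen_ord (leqnSn n) j) ∘ f ∘ (r ∘ i (widen_ord (leqnSn n) k))
    = p (widen_ord (leqnSn n) j) ∘ i (widen_ord (leqnSn n) k).
  rewrite comp_mid (_ : f ∘ r = idm B - i ord_max ∘ p ord_max); last first.
    by rewrite -e addrK.
  by rewrite compBr compBl compm1 -!compA (pi0 ord_max) ?neq // !comp0r subr0.
split=> [j|j k jk|]; rewrite ?key ?pi //; first by apply: pi0; rewrite -val_eqE.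
under eq_bigr => j _ do rewrite comp_mid.
rewrite -comp_suml -comp_sumr.
have -> : \sum_(j < n) i (widen_ord (leqnSn n) j) ∘ p (widen_ord (leqnSn n) j)
    = idm B - i ord_max ∘ p ord_max.
  by rewrite -sum big_ord_recr /= addrK.
by rewrite compBr compBl compm1 rf -!compA (dist_gf d) !comp0r subr0.
Qed.

Lemma dirsum_filt (fac : int -> D -> Prop) k n (X : 'I_n -> D) B :
  (forall i, fac k (X i)) -> is_dirsum X B -> filt fac (nseq n k) B.
Proof.
elim: n X B => [|n IH] X B facX; first by move=> /dirsum0; apply: filt_nil.
move=> /dirsum_split[B' bB /IH fB'].
exact: filt_tri (fB' _) (facX _) (tri_biprod bB).
Qed.

End DirectSums.

Section CoTStructure.
Variables (K : fieldType) (D : tricat K) (b : cot_structure D).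
Implicit Types X Y Z W E : D.

Definition cL := lev (cge b).
Definition cM := lev (cle b).
Definition cH X := cge b X /\ cle b X.

Lemma cge_isom X Y : isom X Y -> cge b X -> cge b Y.
Proof. by have [h _ _] := cge_additive b; apply: h. Qed.

Lemma cle_isom X Y : isom X Y -> cle b X -> cle b Y.
Proof. by have [h _ _] := cle_additive b; apply: h. Qed.

Lemma cL_isom k X Y : isom X Y -> cL k X -> cL k Y.
Proof. exact: lev_isom cge_isom _ _ _. Qed.

Lemma cM_isom k X Y : isom X Y -> cM k X -> cM k Y.
Proof. exact: lev_isom cle_isom _ _ _. Qed.

Lemma cL_shift k X : cL k X -> cL (k + 1) (shift D X).
Proof. exact: (proj2 (lev_shift cge_isom _ _)). Qed.

Lemma cM_shift k X : cM k X -> cM (k + 1) (shift D X).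
Proof. exact: (proj2 (lev_shift cle_isom _ _)). Qed.

Lemma cM_pred k X : cM (k + 1) X -> cM k X.
Proof.
move=> /cle_shift; apply: cle_isom.
apply: isom_trans (isom_sym (isom_shiftzS _ _)) _.
by rewrite opprD subrK; apply: isom_refl.
Qed.

Lemma cL_succ k X : cL k X -> cL (k + 1) X.
Proof.
move=> /cge_unshift; apply: cge_isom.
apply: isom_trans (isom_sym (isom_shiftzD (-1) _ _)) _.
by rewrite opprD addrC; apply: isom_refl.
Qed.

Lemma cL_le k l X : k <= l -> cL k X -> cL l X.
Proof.
move=> kl; rewrite -[l](subrK k) addrC -[l - k]gez0_abs ?subr_ge0 // => Vk.
elim: `|_|%N => [|n IH]; first by rewrite addr0.
by rewrite -addn1 PoszD addrA; apply: cL_succ.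
Qed.

Lemma cM_ge k l X : l <= k -> cM k X -> cM l X.
Proof.
move=> kl; rewrite -[k](subrK l) addrC -[k - l]gez0_abs ?subr_ge0 //.
elim: `|_|%N => [|n IH]; first by rewrite addr0.
by rewrite -addn1 PoszD addrA => /cM_pred.
Qed.

(** Vanishing runs from lower to higher levels, opposite to [tUV_hom0]; accordingly sorted lists now
    decrease when read from the outside. *)
Lemma cLM_hom0 k l X Y : k < l -> cL k X -> cM l Y -> hom0 X Y.
Proof.
move=> kl Lk Ml; apply: (proj2 (hom0_shiftz (- l) _ _)).
move=> f; apply: cot_orth _ Ml f; apply: (proj2 (shiftedP _ _ cge_isom)).
have : cL (l - 1) X by apply: cL_le Lk; rewrite lerBrDr lezD1.
apply: cge_isom; apply: isom_trans (isom_shiftzD _ _ _).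
by rewrite opprB opprK; apply: isom_refl.
Qed.

Lemma cot_dec k X : exists A B, [/\ cL k A, cM (k + 1) B & tri A X B].
Proof.
have [A [B [f [g [h [Age Ble d]]]]]] := cot_decomp b (shiftz (- (k + 1)) X).
exists (shiftz (k + 1) A), (shiftz (k + 1) B); split.
- move: Age => /(shiftedP _ _ cge_isom) => Age.
  apply: cge_isom Age; apply: isom_trans (isom_shiftzD _ _ _).
  by rewrite addKr; apply: isom_refl.
- exact: lev_shiftz0 cle_isom _ _ Ble.
have : tri A (shiftz (- (k + 1)) X) B by exists f, g, h.
move=> /(tri_shiftz (k + 1)); apply: tri_isom; try exact: isom_refl.
exact: isom_shiftzN.
Qed.

Lemma cL_retract k X Y : retract X Y -> cL k Y -> cL k X.
Proof.
move=> /(isom_shiftz_retract (- k))/retract_summand[Z bY].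
exact: cge_summands bY.
Qed.

Lemma cM_retract k X Y : retract X Y -> cM k Y -> cM k X.
Proof.
move=> /(isom_shiftz_retract (- k))/retract_summand[Z bY].
exact: cle_summands bY.
Qed.

(** The identity of [X] factors through [A], so [X] is a retract of [A]; closure under summands
    replaces the vanishing of [B] used for t-structures. *)
Lemma cL_char k X : (forall B, cM (k + 1) B -> hom0 X B) -> cL k X.
Proof.
move=> h; have [A [B [LA MB [f [g [w d]]]]]] := cot_dec k X.
have [|v fv] := dist_liftf (u := idm X) d; first exact: h.
by apply: cL_retract LA; exists v, f.
Qed.

Lemma cM_char k X : (forall A, cL k A -> hom0 A X) -> cM (k + 1) X.
Proof.
move=> h; have [A [B [LA MB [f [g [w d]]]]]] := cot_dec k X.
have [|v fv] := dist_factg (u := idm X) d; first exact: h.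
by apply: cM_retract MB; exists g, v.
Qed.

Lemma cL_ext k X Y Z : tri X Y Z -> cL k X -> cL k Z -> cL k Y.
Proof.
move=> t LX LZ; apply: cL_char => B MB.
have lk : k < k + 1 by rewrite ltrDl.
exact: tri_hom0_midl t (cLM_hom0 lk LX MB) (cLM_hom0 lk LZ MB).
Qed.

Lemma cM_ext k X Y Z : tri X Y Z -> cM k X -> cM k Z -> cM k Y.
Proof.
move=> t; rewrite -[k](subrK 1) => MX MZ; apply: cM_char => A LA.
have lk : k - 1 < k - 1 + 1 by rewrite ltrDl.
exact: tri_hom0_mid t (cLM_hom0 lk LA MX) (cLM_hom0 lk LA MZ).
Qed.

Lemma cL_zero k X : is_zero X -> cL k X.
Proof. by move=> X0; apply: cL_char => B _; apply: hom0_zerol. Qed.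

Lemma cM_zero k X : is_zero X -> cM k X.
Proof.
by move=> X0; rewrite -[k](subrK 1); apply: cM_char => B _; apply: hom0_zeror.
Qed.

Definition ind k Z :=
  exists2 C : coheart b, indecomposable C & isom Z (shiftz k (sval C)).

Lemma ind_isom k Z Z' : isom Z Z' -> ind k Z -> ind k Z'.
Proof.
by move=> e [C iC eC]; exists C => //; apply: isom_trans (isom_sym e) eC.
Qed.

Lemma ind_shiftz j k Z : ind k Z -> ind (j + k) (shiftz j Z).
Proof.
move=> [S sS eS]; exists S => //; apply: isom_trans (isom_shiftz j eS) _.
exact/isom_sym/isom_shiftzD.
Qed.

Lemma ind_cL k Z : ind k Z -> cL k Z.
Proof.
move=> [S _ eS]; apply: cL_isom (isom_sym eS) _.
by apply: (lev_shiftz0 cge_isom); have [] := svalP S.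
Qed.

Lemma ind_cM k Z : ind k Z -> cM k Z.
Proof.
move=> [S _ eS]; apply: cM_isom (isom_sym eS) _.
by apply: (lev_shiftz0 cle_isom); have [] := svalP S.
Qed.

Hypothesis ks : krull_schmidt (coheart b).

Lemma coheart_zero (X : coheart b) : is_zero X <-> is_zero (sval X).
Proof. by split=> /is_zeroP h; apply/is_zeroP. Qed.

Lemma coheart_local (X : coheart b) : local_end X <-> local_end (sval X).
Proof. by split=> -[X0 loc]; split=> // /coheart_zero. Qed.

Lemma coheart_dirsum n (X : 'I_n -> coheart b) B :
  is_dirsum X B -> is_dirsum (fun i => sval (X i)) (sval B).
Proof. by []. Qed.

(** Splitting one local summand off [X] in [D] leaves a complement that lies in the co-heart by
    closure under summands, so that indecomposability applies to it. *)
Lemma indec_local (X : coheart b) : indecomposable X -> local_end (sval X).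
Proof.
move=> [X0 dec]; have [[|n] [Y [loc /coheart_dirsum sum]]] := ks X.
  by case: X0; apply/coheart_zero; apply: dirsum0 sum.
have [B' bB _] := dirsum_split sum.
have HB : cH B'.
  have [ge le] := svalP X.
  by split; [apply: cge_summands bB ge|apply: cle_summands bB le].
have [|B0|Y0] := dec (exist cH B' HB) (Y ord_max); first exact: bB.
  apply: local_isom (proj1 (coheart_local _) (loc ord_max)).
  apply: biprod_zero_isom (biprod_sym bB) _; exact: (proj1 (coheart_zero _) B0).
by have [] := loc ord_max.
Qed.

Lemma ind_local k Z : ind k Z -> local_end Z.
Proof.
move=> [C /indec_local lC eC].
by apply: local_isom (isom_sym eC) _; apply: (proj1 (local_shiftz k _)).
Qed.

Lemma ind_nonzero k Z : ind k Z -> ~ is_zero Z.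
Proof. by move=> /ind_local[]. Qed.

Lemma coheart_filt n (Y : 'I_n -> coheart b) (X : coheart b) :
  (forall i, indecomposable (Y i)) -> is_dirsum Y X -> filt ind (nseq n 0) (sval X).
Proof.
move=> iY /coheart_dirsum; apply: dirsum_filt => i.
by exists (Y i) => //; apply: isom_refl.
Qed.

Lemma sigma_filt0 (X : coheart b) : filt ind (nseq (sigma X) 0) (sval X).
Proof.
have /(xgetPex 0%N)[Y [iY sY]] : exists n : nat, exists Y : 'I_n -> coheart b,
    (forall i, indecomposable (Y i)) /\ is_dirsum Y X.
  have [n [Y [loc sY]]] := ks X; exists n, Y; split=> // i.
  exact: local_indec.
exact: coheart_filt sY.
Qed.

Lemma sigma_filt k (X : coheart b) :
  filt ind (nseq (sigma X) k) (shiftz k (sval X)).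
Proof.
have := filt_shiftz (j := k) (fun l => @ind_shiftz k l) (sigma_filt0 X).
by rewrite map_nseq addr0.
Qed.

End CoTStructure.

(** * The radical, and cancellation of indecomposable factors *)

Section Radical.
Variables (K : fieldType) (D : tricat K) (b : cot_structure D).
Hypothesis KS : krull_schmidt (coheart b).
Implicit Types X Y Z W T : D.

(* Sums of maps factoring through a non-invertible map [W -> Z] with [W]
   indecomposable in the same degree as [Z]. *)
Inductive rad k Z X : Hom X Z -> Prop :=
| rad0 : rad k 0
| radD g W (u : Hom X W) (r : Hom W Z) :
    rad k g -> ind b k W -> ~ is_iso r -> rad k (g + r ∘ u).

Lemma rad_comp k Z X Y (g : Hom X Z) (v : Hom Y X) : rad k g -> rad k (g ∘ v).
Proof.
elim=> [|g' W u r _ IH iW nr]; first by rewrite comp0l; apply: rad0.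
by rewrite compDl -compA; apply: radD.
Qed.

Lemma rad_add k Z X (g h : Hom X Z) : rad k g -> rad k h -> rad k (g + h).
Proof.
move=> rg; elim=> [|h' W u r _ IH iW nr]; first by rewrite addr0.
by rewrite addrA; apply: radD.
Qed.

(** Each term [r u] is a non-unit of the local ring End(Z) by [local_comp_iso], and non-units are
    closed under sums. *)
Lemma rad_noniso k Z (g : Hom Z Z) : ind b k Z -> rad k g -> ~ is_iso g.
Proof.
move=> iZ; have Z0 := ind_nonzero KS iZ; have [_ loc] := ind_local KS iZ.
elim=> [[v [v0 _]]|h W u r _ nh iW nr]; last first.
  apply: loc => // isoru; apply: nr.
  exact: local_comp_iso (ind_local KS iW) Z0 isoru.
by apply: Z0; apply/is_zeroP; rewrite -v0 comp0r.
Qed.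

Lemma rad_section k Z X (g : Hom X Z) (s : Hom Z X) :
  ind b k Z -> rad k g -> g ∘ s <> idm Z.
Proof.
move=> iZ /(rad_comp s)/(rad_noniso iZ) ng e; apply: ng; rewrite e.
exact: is_iso_id.
Qed.

(** Each [u : X -> V] is extended separately: the obstruction lies in Hom(Z, Sigma V), with [Z] in
    level at most [k] and [Sigma V] in level [k + 1]. *)
Lemma rad_extend k l X Y Z W (f : Hom X Y) (g : Hom Y Z) h (c : Hom X W) :
  dist f g h -> cL b l Z -> l <= k -> rad k c ->
  exists2 c' : Hom Y W, c' ∘ f = c & rad k c'.
Proof.
move=> d LZ lk; elim=> [|c1 V u r _ [c1' e1 rc1'] iV nr].
  by exists 0; [rewrite comp0l|apply: rad0].
have [|u' eu'] := dist_factf u d.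
  apply: cLM_hom0 LZ (cM_shift (ind_cM iV)); lia.
exists (c1' + r ∘ u'); last exact: radD.
by rewrite compDl e1 -compA eu'.
Qed.

Lemma filt_ind_cL k l X : filt (ind b) l X -> all (<= k) l -> cL b k X.
Proof.
move=> fX /allP kks; apply: filt_closed fX.
- by move=> *; apply: cL_zero.
- by move=> j Z /kks kj /ind_cL; apply: cL_le.
- by move=> *; apply: cL_ext; eassumption.
Qed.

Lemma filt_ind_cM k l X : filt (ind b) l X -> all (>= k) l -> cM b k X.
Proof.
move=> fX /allP kks; apply: filt_closed fX.
- by move=> *; apply: cM_zero.
- by move=> j Z /kks kj /ind_cM; apply: cM_ge.
- by move=> *; apply: cM_ext; eassumption.
Qed.

Lemma filt_nseq_cL k n X : filt (ind b) (nseq n k) X -> cL b k X.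
Proof. by move=> fX; apply: filt_ind_cL fX _; rewrite all_nseq /= lexx orbT. Qed.

Lemma filt_nseq_cM k n X : filt (ind b) (nseq n k) X -> cM b k X.
Proof. by move=> fX; apply: filt_ind_cM fX _; rewrite all_nseq /= lexx orbT. Qed.

(** Both fibres are the cone of the same section [s], up to the isomorphism [g' s] between [Z] and
    [Z']. *)
Lemma common_section X Y Z X' Z' (f : Hom X Y) (g : Hom Y Z) h
    (f' : Hom X' Y) (g' : Hom Y Z') h' (s : Hom Z Y) :
  dist f g h -> dist f' g' h' -> g ∘ s = idm Z -> is_iso (g' ∘ s) -> isom X X'.
Proof.
move=> d d' gs [v [vg gv]].
have [r _ dr] := dist_section_dist d gs.
have [|r' _ dr'] := @dist_section_dist _ _ _ _ _ _ _ _ (s ∘ v) d'.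
  by rewrite compA.
have isov : is_iso (g' ∘ s) by exists v.
have [|c [isoc _ _]] := cone_uniq dr dr' isov (is_iso_id Y).
  by rewrite comp1m -compA vg compm1.
by exists c.
Qed.

Lemma outer_section k n Y X Z (f : Hom Y X) (g : Hom X Z) h :
  filt (ind b) (nseq n k) Y -> ind b k Z -> dist f g h ->
  exists s : Hom Z X, g ∘ s = idm Z.
Proof.
move=> fY iZ d; have lk : k < k + 1 by rewrite ltrDl.
have h0 := cLM_hom0 lk (ind_cL iZ) (cM_shift (filt_nseq_cM fY)) h.
by apply: dist_liftg d _; rewrite h0 comp0l.
Qed.

(** Krull-Schmidt exchange inside one layer. If [c] is not radical on the inner part [T1], induction
    applies there. Otherwise subtracting a radical extension leaves a map [e] on the outer factor
    [Z1], invertible because [c] is not radical, and [T1] is the fibre. *)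
Lemma ks_remove k n T Z Y (y : Hom Y T) (c : Hom T Z) h :
  filt (ind b) (nseq n k) T -> ind b k Z -> dist y c h -> ~ rad k c ->
  (exists s : Hom Z T, c ∘ s = idm Z) /\
  (exists2 n', n = n'.+1 & filt (ind b) (nseq n' k) Y).
Proof.
move=> + iZ; elim: n T Y y c h => [|n IH] T Y y c h.
  move=> /filt_nilE T0 _ []; rewrite (hom0_zerol T0 c); exact: rad0.
move=> /filt_consE[T1 [Z1 [f1 [g1 [h1 [fT1 iZ1 d1]]]]]] d nrad.
have [rc|nrc] := pselect (rad k (c ∘ f1)); last first.
  have [W [w [k' dw]]] := cocone_ex (c ∘ f1).
  have [[s cs] [n' -> fW]] := IH _ _ _ _ _ fT1 dw nrc.
  split; first by exists (f1 ∘ s); rewrite compA.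
  exists n'.+1 => //; have [u [v [duv _]]] := oct_mid d1 d dw.
  exact: filt_cons fW iZ1 duv.
have [c' c'f rc'] := rad_extend d1 (ind_cL iZ1) (lexx k) rc.
have [|e eg] := dist_factg (u := c - c') d1.
  by rewrite compBl c'f subrr.
have ec : c = c' + e ∘ g1 by rewrite eg addrC subrK.
have [[e' [e'e ee']]|ne] := pselect (is_iso e); last first.
  by case: nrad; rewrite ec; apply: radD.
have [s1 g1s1] := outer_section fT1 iZ1 d1.
(* This composite is the identity plus a radical endomorphism of [Z], hence invertible since End(Z)
   is local. *)
have isocs : is_iso (c ∘ (s1 ∘ e')).
  have [//|ni] := pselect (is_iso (c ∘ (s1 ∘ e'))).
  have [_ loc] := ind_local KS iZ.
  have ni' : ~ is_iso (- (c' ∘ (s1 ∘ e'))).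
    move=> /is_iso_opp; rewrite opprK; apply: rad_noniso iZ _; exact: rad_comp.
  case: (loc _ _ ni ni'); rewrite -compBl ec addrC addKr.
  by rewrite -compA (compA g1) g1s1 comp1m ee'; apply: is_iso_id.
have [v [vc cv]] := isocs.
split; first by exists (s1 ∘ e' ∘ v); rewrite compA.
exists n => //; apply: filt_isom fT1.
apply: isom_sym; apply: (common_section (s := s1 ∘ e' ∘ v) d d1).
  by rewrite compA.
rewrite !compA g1s1 comp1m.
by apply: is_iso_comp; [exists e|exists (c ∘ (s1 ∘ e'))].
Qed.

(** Identifies the value that [xget] picks for [sigma] with the length of any one-layer
    filtration. *)
Lemma filt_ind_uniq k n m T :
  filt (ind b) (nseq n k) T -> filt (ind b) (nseq m k) T -> n = m.
Proof.
elim: n m T => [|n IH] m T.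
  move=> /filt_nilE T0; case: m => // m.
  move=> /filt_consE[Y [Z [f [g [h [fY iZ d]]]]]].
  case: (ind_nonzero KS iZ); apply/is_zeroP.
  have [s <-] := outer_section fY iZ d.
  by rewrite (hom0_zerol T0 g) comp0l.
move=> /filt_consE[Y [Z [f [g [h [fY iZ d]]]]]] fT.
have [s gs] := outer_section fY iZ d.
have ng : ~ rad k g by move=> /(rad_section iZ)/(_ gs).
by have [_ [m' -> fY']] := ks_remove fT iZ d ng; rewrite (IH _ _ fY fY').
Qed.

Lemma ge_sortedE (k : int) l : sorted >=%R (k :: l) = all (<= k) l && sorted >=%R l.
Proof. by apply: path_sortedE => x y z /= yx zy; apply: le_trans zy yx. Qed.

Lemma sorted_layer (k : int) (l : seq int) : sorted >=%R l -> all (<= k) l ->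
  exists n l', [/\ l = nseq n k ++ l', sorted >=%R l' & all (<= (k - 1)) l'].
Proof.
elim: l => [|j l IH]; first by exists 0%N, [::].
rewrite ge_sortedE => /andP[jl sl] /= /andP[]; rewrite le_eqVlt => /predU1P[->|jk] kl.
  by have [n [l' [-> sl' kl']]] := IH sl kl; exists n.+1, l'.
exists 0%N, (j :: l); split=> //; first by rewrite ge_sortedE jl.
have jk1 : j <= k - 1 by lia.
by rewrite /= jk1; apply: sub_all jl => x /= xj; apply: le_trans xj jk1.
Qed.

Lemma sorted_layer_cat (k : int) n l : sorted >=%R l -> all (<= (k - 1)) l ->
  sorted >=%R (nseq n k ++ l).
Proof.
move=> sl kl; elim: n => // n IH; rewrite -[nseq n.+1 k ++ l]/(k :: _).
rewrite ge_sortedE IH andbT all_cat all_nseq /= lexx orbT /=.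
by apply: sub_all kl => x /= xk; apply: le_trans xk _; lia.
Qed.

(** The lower layers have no map to level [k], so [g] factors through the top layer; the section
    keeps that factor out of the radical, and [ks_remove] applies. *)
Lemma split_remove k l X Y Z (y : Hom Y X) (g : Hom X Z) h (s : Hom Z X) :
  sorted >=%R l -> all (<= k) l -> filt (ind b) l X -> ind b k Z ->
  dist y g h -> g ∘ s = idm Z ->
  exists l', [/\ sorted >=%R l', filt (ind b) l' Y & perm_eq l (k :: l')].
Proof.
move=> sl kl fX iZ d gs; have [n [l' [el sl' kl']]] := sorted_layer sl kl.
rewrite el in fX *; have [X' [T [fX' fT [x [q [w dq]]]]]] := filt_split fX.
have [|c cq] := dist_factg (u := g) dq.
  apply: cLM_hom0 (filt_ind_cL fX' kl') (ind_cM iZ) _; lia.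
have nc : ~ rad k c.
  by move=> /(rad_comp q); rewrite cq => /(rad_section iZ)/(_ gs).
have [YT [yT [hT dT]]] := cocone_ex c.
have [_ [n' -> fYT]] := ks_remove fT iZ dT nc.
rewrite -cq in d; have [u [v [duv _ _]]] := oct_cocone dq dT d.
exists (nseq n' k ++ l'); split=> //; first exact: sorted_layer_cat.
by apply: filt_cat fX' fYT _; exists u, v; eexists; apply: duv.
Qed.

(* Splitting off [Z] from the top layer [T] of [X], although [X -> Z] is
   zero, produces a copy of [Z[-1]] in the next layer; both can be removed. *)
Lemma cancel_layer k n l X' X T Z (x : Hom X' X) (q : Hom X T) w (c : Hom T Z) :
  sorted >=%R l -> all (<= (k - 1)) l -> filt (ind b) l X' ->
  filt (ind b) (nseq n k) T -> dist x q w -> ind b k Z -> ~ rad k c ->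
  c ∘ q = 0 ->
  exists l', [/\ sorted >=%R l', filt (ind b) l' X
    & perm_eq (nseq n k ++ l) [:: k, k - 1 & l']].
Proof.
move=> sl kl fX' fT dq iZ nc cq.
have [YT [yT [hT dT]]] := cocone_ex c.
have [_ [n' -> fYT]] := ks_remove fT iZ dT nc.
(* As [c q] is zero, the fibre [P] is the sum of [X] and the desuspension of [Z]; by the octahedral
   axiom it is also an extension of [YT] by [X']. *)
have [P [p [hP dP]]] := cocone_ex (c ∘ q).
have [u [v [duv _ _]]] := oct_cocone dq dT dP.
rewrite cq in dP.
have [|s ps] := dist_liftf (u := idm X) dP; first by rewrite comp0l.
have [N [i [hN dN]]] := cocone_ex p.
have [r ri dr] := dist_section_dist dN ps.
have NZ : isom (shift D N) Z.
  have [|e [isoe _ _]] := cone_uniq (dist_rot1 dN) dP (is_iso_id P) (is_iso_id X).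
    by rewrite comp1m compm1.
  by exists e.
have iN : ind b (k - 1) N.
  rewrite addrC; apply: ind_isom (isom_unshiftK N) _.
  by apply: (@ind_shiftz _ _ b (-1)); apply: ind_isom (isom_sym NZ) iZ.
have kk : k - 1 < k by lia.
(* [N], in level [k - 1], has no map to [YT], in level [k]; so its inclusion into [P] lifts to [X']
   and makes [N] a summand of [X']. *)
have [|m um] := dist_liftf (u := i) duv.
  exact: cLM_hom0 kk (ind_cL iN) (filt_nseq_cM fYT) _.
have [Y' [y' [hY dY]]] := cocone_ex (r ∘ u).
have [|l' [sl' fY' pl']] := split_remove (s := m) sl kl fX' iN dY.
  by rewrite -compA um.
have kl' : all (<= (k - 1)) l'.
  by have := kl; rewrite (perm_all _ pl') => /andP[].
have [u' [v' [d' _]]] := oct_mid duv dr dY.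
exists (nseq n' k ++ l'); split; first exact: sorted_layer_cat.
  by apply: filt_cat fY' fYT _; exists u'; do 2! eexists; apply: d'.
rewrite /= perm_cons; rewrite -(perm_cat2l (nseq n' k)) in pl'.
apply: (perm_trans pl').
by rewrite -cat1s -(cat1s (k - 1) (nseq n' k ++ l')) perm_catCA.
Qed.

End Radical.

(** * Minimal sorted filtrations by indecomposable objects *)

Section MinimalFiltrations.
Variables (K : fieldType) (D : tricat K) (b : cot_structure D).
Hypothesis KS : krull_schmidt (coheart b).
Implicit Types X Y Z W T F E : D.

(** Minimality refers to length, so the list does not depend on [t]; by [minimal_sub1] its weight is
    least as well. *)
Definition minimal_filt F l :=
  [/\ sorted >=%R l, filt (ind b) l F
    & forall l', filt (ind b) l' F -> (size l <= size l')%N].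

Lemma ge_total_int : total (>=%R : rel int).
Proof. by move=> x y; apply: le_total. Qed.

Lemma ge_trans_int : transitive (>=%R : rel int).
Proof. by move=> x y z /= yx zy; apply: le_trans zy yx. Qed.

Lemma filt_ind_sort l X : filt (ind b) l X -> exists ms rest,
  [/\ sorted >=%R ms, filt (ind b) ms X & perm_eq (ms ++ rest) l].
Proof.
apply: filt_sort; [exact: ge_total_int|exact: ge_trans_int|].
move=> k j A W B iA iB; rewrite -ltNge => jk t; right.
apply: tri_swap t _; apply: cLM_hom0 (ind_cL iB) (cM_shift (ind_cM iA)); lia.
Qed.

Lemma minimal_nil F : is_zero F -> minimal_filt F [::].
Proof. by move=> F0; split=> //; apply: filt_nil. Qed.

Lemma minimal_ex l F : filt (ind b) l F -> exists l', minimal_filt F l'.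
Proof.
move=> fF.
have ex : exists n, `[< exists2 l', filt (ind b) l' F & size l' = n >].
  by exists (size l); apply/asboolP; exists l.
have [n /asboolP[l1 f1 <-] min] := ex_minnP ex.
have [ms [rest [sms fms p]]] := filt_ind_sort f1.
have szm : (size ms <= size l1)%N.
  by rewrite -(perm_size p) size_cat leq_addr.
exists ms; split=> // l' fl'; apply: leq_trans szm _; apply: min.
by apply/asboolP; exists l'.
Qed.

(* A radical factorisation of [X -> F -> Z] through the top layer of [X] would
   make the top of [F] cancel, against minimality. *)
Lemma minimal_biprod k l F l' F' X m :
  minimal_filt F (k :: l) -> minimal_filt F' l' -> all (<= k) l' ->
  is_biprod F F' X -> sorted >=%R m -> filt (ind b) m X -> all (<= k) m ->
  exists F1 Y m', [/\ minimal_filt F1 l, is_biprod F1 F' Y, sorted >=%R m',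
    filt (ind b) m' Y & perm_eq m (k :: m')].
Proof.
move=> [sF fF minF] minF' kl' bX sm fX km.
have kl : all (<= k) (k :: l).
  by move: sF; rewrite ge_sortedE /= lexx => /andP[].
have [[|n] [l2 [el sl2 kl2]]] := sorted_layer sF kl.
  by move: kl2; rewrite -[l2]/([::] ++ l2) -[_ ++ _]el /= => /andP[]; lia.
case: el => el; rewrite el in fF minF kl sF *.
rewrite -[k :: _]/(nseq n.+1 k ++ l2) in fF.
have [F1 [TF [fF1 fTF [f [qF [w dF]]]]]] := filt_split fF.
have [T' [Z [f' [pi [w' [fT' iZ dT]]]]]] := filt_consE fTF.
have [s pis] := outer_section fT' iZ dT.
have [Fg [g' [hg dg]]] := cocone_ex (pi ∘ qF).
have fFg : filt (ind b) (nseq n k ++ l2) Fg.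
  have [u [v [duv _ _]]] := oct_cocone dF dT dg.
  by apply: filt_cat fF1 fT' _; exists u, v; eexists; apply: duv.
have minFg : minimal_filt Fg (nseq n k ++ l2).
  split=> //; first by move: sF; rewrite ge_sortedE => /andP[].
  move=> l3 fl3; rewrite -ltnS; apply: (minF (k :: l3)).
  exact: filt_cons fl3 iZ dg.
have [m0 [m2 [em sm2 km2]]] := sorted_layer sm km.
rewrite em in fX *; have [X' [T [fX' fT [x [q [wX dX]]]]]] := filt_split fX.
have [i1 [i2 [p1 [p2 e]]]] := bX; have [p1i1 _ _ _ _] := e.
have kk : k - 1 < k by lia.
have [|c cq] := dist_factg (u := pi ∘ qF ∘ p1) dX.
  exact: (cLM_hom0 kk (filt_ind_cL fX' km2) (ind_cM iZ)).
have [rc|nrc] := pselect (rad b k c); last first.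
  have [YT [yT [hT dYT]]] := cocone_ex c.
  have [_ [n' -> fYT]] := ks_remove KS fT iZ dYT nrc.
  have [Y [y [hY dY]]] := cocone_ex (c ∘ q).
  have [u [v [duv _ _]]] := oct_cocone dX dYT dY.
  exists Fg, Y, (nseq n' k ++ m2); split=> //.
  - by apply: biprod_fibre dg e _ _ _ _; rewrite -cq; apply: dY.
  - exact: sorted_layer_cat.
  - by apply: filt_cat fX' fYT _; exists u, v; eexists; apply: duv.
(* [mm] is the map of top layers induced by the inclusion of [F]. The difference of [pi] and [c mm]
   vanishes on [F], but is not radical because [pi] has a section. *)
have [|mm emm] := dist_factg (u := q ∘ i1) dF.
  exact: (cLM_hom0 kk (filt_ind_cL fF1 kl2) (filt_nseq_cM fT)).
have vanish : (pi - c ∘ mm) ∘ qF = 0.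
  by rewrite compBl -(compA c) emm compA cq -compA p1i1 compm1 subrr.
have nr : ~ rad b k (pi - c ∘ mm).
  move=> /rad_add/(_ (rad_comp mm rc)); rewrite subrK.
  by move=> /(rad_section KS iZ)/(_ pis).
have [l3 [_ fl3 p3]] := cancel_layer KS sl2 kl2 fF1 fTF dF iZ nr vanish.
have := minF _ fl3; have := perm_size p3; rewrite /= => ->; lia.
Qed.

(** Living below level [k], [X] has the zero map to its own top layer, so a split projection of that
    layer meets the hypotheses of [cancel_layer]. *)
Lemma filt_cancel_top k l X : sorted >=%R (k :: l) -> filt (ind b) (k :: l) X ->
  cL b (k - 1) X ->
  exists l', [/\ sorted >=%R l', filt (ind b) l' X
    & perm_eq (k :: l) [:: k, k - 1 & l']].
Proof.
move=> sl fX LX.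
have kl : all (<= k) (k :: l).
  by move: sl; rewrite ge_sortedE /= lexx => /andP[].
have [[|n] [l2 [el sl2 kl2]]] := sorted_layer sl kl.
  by move: kl2; rewrite -[l2]/([::] ++ l2) -[_ ++ _]el /= => /andP[]; lia.
rewrite el in fX *.
have [X' [T [fX' fT [x [q [w dX]]]]]] := filt_split fX.
have [T' [Z [f' [pi [w' [fT' iZ dT]]]]]] := filt_consE fT.
have [s pis] := outer_section fT' iZ dT.
have kk : k - 1 < k by lia.
have q0 : q = 0 := cLM_hom0 kk LX (filt_nseq_cM fT) q.
apply: (cancel_layer KS sl2 kl2 fX' fT dX iZ (c := pi)).
  by move=> /(rad_section KS iZ)/(_ pis).
by rewrite q0 comp0r.
Qed.

Definition head_ge (l l' : seq int) : bool :=
  match l, l' with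
  | k :: _, k' :: _ => k' <= k | _, [::] => true | [::], _ :: _ => false
  end.

(** By symmetry [k], the head of [l], is the largest label of both summands. If no label of [m]
    exceeds it, [minimal_biprod] removes [k] on both sides; otherwise [X] lies below the top of [m],
    whose label cancels with one a degree lower. *)
Lemma minimal_sub (l l' m : seq int) F F' X : is_biprod F F' X ->
  minimal_filt F l -> minimal_filt F' l' ->
  sorted >=%R m -> filt (ind b) m X ->
  exists rest, perm_eq ((l ++ l') ++ rest) m.
Proof.
have [n] := ubnP (size l + size l' + size m)%N.
elim: n l l' m F F' X => // n IH l l' m F F' X.
wlog: l l' F F' / head_ge l l'.
  move=> H sz bX mF mF' sm fX.
  have [c|c] : head_ge l l' \/ head_ge l' l.
  - case: l l' {sz mF mF'} => [|k l] [|k' l'] /=; [by left|by right|by left|].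
    exact/orP/ge_total_int.
  - exact: H c sz bX mF mF' sm fX.
  have [rest p] : exists rest, perm_eq ((l' ++ l) ++ rest) m.
    by apply: (H l' l F' F c _ (biprod_sym bX)) => //; rewrite (addnC (size l')) .
  by exists rest; apply: perm_trans p; rewrite perm_cat2r perm_catC.
case: l => [|k l] c sz bX mF mF' sm fX.
  by case: l' c sz mF' => // *; exists m.
have kl' : all (<= k) l'.
  have [sl' _ _] := mF'; case: l' c sl' {sz mF'} => //= k' l' kk'.
  rewrite (path_sortedE ge_trans_int) => /andP[k'l' _]; rewrite kk' /=.
  by apply: sub_all k'l' => x /= xk'; apply: le_trans xk' kk'.
have [km|km] := boolP (all (<= k) m).
  have [F1 [Y [m' [mF1 bY sm' fY p]]]] := minimal_biprod mF mF' kl' bX sm fX km.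
  have [|rest p'] := IH _ _ _ _ _ _ _ bY mF1 mF' sm' fY.
    move: sz; rewrite (perm_size p) /=; lia.
  by exists rest; rewrite perm_sym (permPl p) /= perm_cons perm_sym.
case: m km sm fX sz => // j m km sm fX sz.
have kj : k < j.
  rewrite ltNge; apply: contra km => jk /=; rewrite jk /=.
  move: sm; rewrite ge_sortedE => /andP[jm _].
  by apply: sub_all jm => x /= xj; apply: le_trans xj jk.
have LX : cL b (j - 1) X.
  apply: (@cL_le _ _ _ k); first by lia.
  have [sF fF _] := mF; have [_ fF' _] := mF'.
  apply: cL_ext (tri_biprod bX) (filt_ind_cL fF _) (filt_ind_cL fF' kl').
  by move: sF; rewrite ge_sortedE /= lexx => /andP[].
have [m' [sm' fX' p]] := filt_cancel_top sm fX LX.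
have [|rest p'] := IH _ _ _ _ _ _ _ bX mF mF' sm' fX'.
  move: sz; have := perm_size p; rewrite /= => -[->]; lia.
exists ([:: j; j - 1] ++ rest); rewrite perm_sym (permPl p) perm_sym.
by rewrite perm_catCA /= !perm_cons.
Qed.

Lemma minimal_sub1 l m F : minimal_filt F l -> filt (ind b) m F ->
  exists rest, perm_eq (l ++ rest) m.
Proof.
move=> mF /filt_ind_sort[ms [rest [sms fms p]]].
have [[N N0] _] := tcat_additive D.
have [rest' p'] := minimal_sub (biprod0 F N0) mF (minimal_nil N0) sms fms.
exists (rest' ++ rest); rewrite cats0 in p'; apply: perm_trans p.
by rewrite catA perm_cat2r.
Qed.

End MinimalFiltrations.

(** * The infimum over co-t-filtrations *)

Section CheckDelta.
Variables (R : realType) (t : R) (K : fieldType) (D : tricat K).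
Variable b : cot_structure D.
Hypotheses (bnd : cot_bounded b) (fin : finite_krull_schmidt (coheart b)).
Implicit Types X Y Z G F E : D.

Let KS : krull_schmidt (coheart b) := fin.1.

Lemma coheart_lift k X : cL b k X -> cM b k X ->
  exists C : coheart b, isom X (shiftz k (sval C)).
Proof.
move=> LX MX; have HX : cH b (shiftz (- k) X) by [].
by exists (exist (cH b) _ HX); apply/isom_sym/isom_shiftzN.
Qed.

(** Induction on the amplitude; here the lowest level is split off as the innermost piece. *)
Lemma filt_ind_ex E : exists l, filt (ind b) l E.
Proof.
have [[l /(lev_shifted (@cge_isom _ _ b)) Ll] [k /(lev_shifted (@cle_isom _ _ b)) Mk]] := bnd E.
have {Ll} : exists n : nat, cL b (k + n%:Z) E.
  by exists `|l - k|%N; apply: cL_le Ll; lia.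
move: Mk; rewrite -/(cM b k E) => + [n]; elim: n k E => [|n IH] k X Mk.
  rewrite addr0 => Lk; have [C eC] := coheart_lift Lk Mk.
  exists (nseq (sigma C) k); apply: filt_isom (isom_sym eC) _.
  exact: sigma_filt.
move=> Lk; have [A [B [LA MB tr]]] := cot_dec b k X.
have LB : cL b (k + 1 + n%:Z) B.
  apply: cL_ext (tri_rot tr) _ (cL_le _ (cL_shift LA)); last by lia.
  by apply: cL_le Lk; lia.
have MA : cM b k A.
  rewrite -[k](subrK 1); apply: cM_char => W LW; apply: tri_hom0_left tr _ _.
    by apply: cLM_hom0 LW Mk; lia.
  by apply: cLM_hom0 (cL_shift LW) MB; lia.
have [l' fB] := IH _ _ MB LB; have [C eC] := coheart_lift LA MA.
exists (l' ++ nseq (sigma C) k); apply: filt_cat _ fB tr.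
by apply: filt_isom (isom_sym eC) _; apply: sigma_filt.
Qed.

Definition min_list F : seq int := xget [::] [set l | minimal_filt b F l].

Lemma min_listP F : minimal_filt b F (min_list F).
Proof.
by have [l /minimal_ex/(xgetPex [::])] := filt_ind_ex F.
Qed.

Lemma weight_min_list l F : filt (ind b) l F -> weight t (min_list F) <= weight t l.
Proof.
by move=> /(minimal_sub1 KS (min_listP F))[rest p]; apply: weight_sub p.
Qed.

Lemma sigmaE k n X (C : coheart b) : isom X (shiftz k (sval C)) ->
  filt (ind b) (nseq n k) X -> sigma C = n.
Proof.
move=> e fX; apply: filt_ind_uniq (sigma_filt KS k C) _ => //.
exact: filt_isom fX.
Qed.

(** Equal labels are merged, layer by layer, into one co-heart object. The clause on predicates
    carries the bound on the labels over to the merged list, which gives strict monotonicity. *)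
Lemma filt_cot_filtration l F : sorted >=%R l -> filt (ind b) l F ->
  exists2 fs : seq (int * coheart b), cot_filtration F fs &
    \sum_(p <- fs) (sigma p.2)%:R * expR (p.1%:~R * t) = weight t l.
Proof.
move=> sl fF; suff [fs [cF ws _]] : exists fs : seq (int * coheart b),
    [/\ cot_filtration F fs,
      \sum_(p <- fs) (sigma p.2)%:R * expR (p.1%:~R * t) = weight t l &
      forall P : pred int, all P l -> all P [seq p.1 | p <- fs]] by exists fs.
have [n] := ubnP (size l); elim: n l F sl fF => // n IH [|k l] F sl fF sz.
  exists [::]; split=> //; last by rewrite big_nil weight_nil.
  by split=> //; apply: filtration0; apply: filt_nilE fF.
have kl : all (<= k) (k :: l).
  by move: sl; rewrite ge_sortedE /= lexx => /andP[].
have [[|m] [l2 [el sl2 kl2]]] := sorted_layer sl kl.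
  by move: kl2; rewrite -[l2]/([::] ++ l2) -[_ ++ _]el /= => /andP[]; lia.
rewrite el in fF sz *; have [F' [T [fF' fT tr]]] := filt_split fF.
have [C eC] := coheart_lift (filt_nseq_cL fT) (filt_nseq_cM fT).
have [|fs [[ffs sfs] wfs allfs]] := IH _ _ sl2 fF'.
  by move: sz; rewrite size_cat /=; lia.
exists (rcons fs (k, C)); split.
- split.
    rewrite map_rcons; apply: filtration_tri ffs _.
    by apply: tri_isom tr; [apply: isom_refl..|].
  rewrite map_rcons (sorted_pairwise lt_trans) pairwise_rcons.
  rewrite -(sorted_pairwise lt_trans) sfs andbT.
  apply: allfs; apply: sub_all kl2 => x /= xk; lia.
- rewrite -cats1 big_cat /= wfs big_seq1 /= (sigmaE eC fT).
  by rewrite -weight_nseq addrC -weight_cat.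
- move=> P; rewrite all_cat => /andP[/andP[Pk _] /allfs Pfs].
  by rewrite map_rcons all_rcons /= Pk.
Qed.

Lemma cot_filtration_filt F (fs : seq (int * coheart b)) : cot_filtration F fs ->
  exists2 l, filt (ind b) l F &
    \sum_(p <- fs) (sigma p.2)%:R * expR (p.1%:~R * t) = weight t l.
Proof.
move=> [ff _]; exists (flatten [seq nseq (sigma p.2) p.1 | p <- rev fs]).
  by apply: filtration_filt ff => p; apply: sigma_filt.
rewrite weight_flatten big_rev.
by apply: eq_bigr => p _; rewrite weight_nseq.
Qed.

(** Every co-t-filtration refines to a filtration by indecomposables of the same weight, and the
    minimal list is contained in it up to order. *)
Lemma check_deltaE F : check_delta b t F = (weight t (min_list F))%:E.
Proof.
have [sF fF _] := min_listP F.
apply/eqP; rewrite eq_le; apply/andP; split.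
  have [fs cF <-] := filt_cot_filtration sF fF.
  by apply: ereal_inf_lbound; exists fs.
apply: le_ereal_inf_tmp => _ [fs [/cot_filtration_filt[l fl ->] ->]].
by rewrite lee_fin weight_min_list.
Qed.

Lemma min_list_built G ls F : built G ls F ->
  weight t (min_list F) <= weight t (min_list G) * weight t ls.
Proof.
move=> [B /retract_summand[F' bB] fB].
have [_ fG _] := min_listP G.
have fB' := filt_built (fun j k Z => @ind_shiftz _ _ b j k Z) fG fB.
have [ms [rest [sms fms p]]] := filt_ind_sort fB'.
rewrite -weight_allpairs; apply: le_trans (weight_sub t p).
have [rest' p'] := minimal_sub KS bB (min_listP F) (min_listP F') sms fms.
by rewrite -catA in p'; apply: weight_sub p'.
Qed.

Lemma built_min_list G : split_generator G ->
  exists2 C : R, 0 <= C & forall F,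
    exists2 ls, built G ls F & weight t ls <= C * weight t (min_list F).
Proof.
move=> genG; have [n [S allS]] := fin.2.
have [|C C0 HC] := @built_weight R t K D (ind b) n (fun i => sval (S i)) G _ genG.
  move=> k Z [T sT eT]; have [i [f isof]] := allS T sT.
  exists i; apply: isom_trans eT _; apply: isom_shiftz.
  by exists f.
exists C => // F; have [_ fF _] := min_listP F.
exact: HC fF.
Qed.

Lemma min_list_gt0 F : ~ is_zero F -> 0 < weight t (min_list F).
Proof. by have [_ fF _] := min_listP F; apply: weightless_zero fF. Qed.

Lemma min_list_zero F : is_zero F -> weight t (min_list F) = 0.
Proof.
move=> F0; have [_ _ /(_ _ (filt_nil _ F0))] := min_listP F.
by rewrite leqn0 => /nilP ->; rewrite weight_nil.
Qed.

End CheckDelta.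

(** * Growth rates *)

Section Fekete.
Variable R : realType.
Implicit Types (u v : (\bar R)^nat).
Local Open Scope ereal_scope.

Lemma limn_esup_le u v : (\forall N \near \oo, u N <= v N) ->
  limn_esup u <= limn_esup v.
Proof.
move=> [N0 _ uv]; rewrite !limn_esup_lim.
apply: lee_lim; [exact: is_cvg_esups|exact: is_cvg_esups|].
exists N0 => // n /= N0n; apply: ge_ereal_sup => _ [m /= nm <-].
apply: le_ereal_sup_tmp; exists (v m); first by exists m.
by apply: uv => /=; apply: leq_trans nm.
Qed.

Lemma cvg_limn_esup u (l : \bar R) : u @ \oo --> l -> limn_esup u = l.
Proof. by move=> ul; rewrite is_cvg_limn_esupE; [apply/cvg_lim|apply/cvg_ex; exists l]. Qed.

Lemma cvg_inv_mul (C : R) : (fun N : nat => (N%:R^-1 * C)%:E) @ \oo --> 0.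
Proof.
rewrite -cvg_shiftS; apply: cvg_EFin; first exact: nearW.
rewrite (_ : _ \o _ = (fun n => harmonic n * C)%R) //.
by rewrite -[X in _ --> X](mul0r C); apply: cvgMl; apply: cvg_harmonic.
Qed.

Lemma cvg_add_inv_mul u (l : \bar R) (C : R) : u @ \oo --> l ->
  (fun N => u N + (N%:R^-1 * C)%:E) @ \oo --> l.
Proof.
move=> ul; rewrite -[X in _ --> X]adde0; apply: cvgeD ul (cvg_inv_mul C).
by rewrite fin_num_adde_defl.
Qed.

Variable a : nat -> R.
Hypothesis a_sub : forall m n, (a (m + n)%N <= a m + a n)%R.

Let u N := (N%:R^-1 * a N)%:E.

Lemma subadditive_mean n : (0 < n)%N ->
  exists C : R, forall N, (0 < N)%N -> u N <= u n + (N%:R^-1 * C)%:E.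
Proof.
move=> n0; pose M : R := (\sum_(r < n) `|a r|)%R.
(* With N = q n + r and r < n, [M] bounds a_r, and the norm of a_n bounds the error r a_n / n. *)
exists (`|a n| + M)%R => N N0.
have N0' : (0 < N%:R :> R)%R by rewrite ltr0n.
have n0' : (0 < n%:R :> R)%R by rewrite ltr0n.
rewrite -EFinD lee_fin -(ler_pM2l N0') mulrDr !mulVKf ?gt_eqF //.
have aqr q r : (a (q * n + r)%N <= q%:R * a n + a r)%R.
  elim: q => [|q IH]; first by rewrite mul0n add0n mul0r add0r.
  rewrite mulSn -addnA; apply: le_trans (a_sub _ _) _.
  by rewrite -[q.+1]add1n natrD mulrDl mul1r -addrA lerD2l.
rewrite {1}(divn_eq N n); apply: le_trans (aqr _ _) _.
have rM : (a (N %% n)%N <= M)%R.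
  apply: le_trans (ler_norm _) _.
  rewrite /M (bigD1 (Ordinal (ltn_pmod N n0))) //= lerDl.
  by apply: sumr_ge0 => *; apply: normr_ge0.
rewrite addrA lerD //; set x := (n%:R^-1 * a n)%R.
have -> : (N%:R * x = (N %/ n)%:R * a n + (N %% n)%:R * x)%R.
  by rewrite {1}(divn_eq N n) natrD natrM mulrDl -mulrA /x mulVKf ?gt_eqF.
rewrite -addrA lerDl /x.
have : (`|(N %% n)%:R * (n%:R^-1 * a n)| <= `|a n|)%R.
  rewrite mulrA normrM ler_piMl ?normr_ge0 // ger0_norm ?divr_ge0 ?ler0n //.
  by rewrite ler_pdivrMr // mul1r ler_nat ltnW // ltn_pmod.
by rewrite ler_norml => /andP[+ _]; rewrite -lerBlDr sub0r.
Qed.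

Lemma fekete : u @ \oo --> ereal_inf [set u n | n in [set n | (0 < n)%N]].
Proof.
(* [u 0] is 0, which may lie below [l]; replacing it by +oo makes [l] a lower bound of the whole
   sequence. *)
set l := ereal_inf _; pose v N := if N is 0%N then +oo else u N.
have uv : \forall N \near \oo, v N = u N by exists 1%N => // -[].
have : v @ \oo --> l; last first.
  by apply: cvg_trans; apply: near_eq_cvg; apply: filterS uv.
apply: limn_esup_le_cvg => [|[|N]]; last 2 first.
- by rewrite leey.
- by apply: ereal_inf_lbound; exists N.+1.
apply: le_ereal_inf_tmp => _ [n /= n0 <-].
have [C uC] := subadditive_mean n0.
rewrite -(cvg_limn_esup (cvg_add_inv_mul C (cvg_cst (u n)))).
by apply: limn_esup_le; exists 1%N => // -[|N] //= _; apply: uC.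
Qed.

End Fekete.

(** * Complexity with respect to a split-generator *)

Section Complexity.
Variables (R : realType) (t : R) (K : fieldType) (D : tricat K) (G : D).
Hypothesis genG : split_generator G.
Implicit Types X Y Z E F : D.

Lemma delta_built F : ~ is_zero F ->
  delta t G F = ereal_inf [set (weight t ks)%:E | ks in [set ks | built G ks F]].
Proof.
move=> F0; rewrite /delta; case: asboolP => // _; congr ereal_inf.
apply/seteqP; split=> [_ [F' [B [ks [bB /filtration_shifts fB ->]]]]|_ [ks [B rB fB] <-]].
  exists (rev ks); first by exists B; [apply: biprod_retract bB|].
  by congr EFin; apply: weight_perm; rewrite perm_rev.
have [F' bB] := retract_summand rB; exists F', B, (rev ks); split=> //.
  by apply/filtration_shifts; rewrite revK.
by congr EFin; apply: weight_perm; rewrite perm_sym perm_rev.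
Qed.

Definition complexity F : R := fine (delta t G F).

Lemma complexity_zero F : is_zero F -> complexity F = 0.
Proof. by rewrite /complexity /delta => F0; case: asboolP. Qed.

Lemma deltaE F : delta t G F = (complexity F)%:E.
Proof.
have [F0|F0] := pselect (is_zero F).
  by rewrite complexity_zero // /delta; case: asboolP.
rewrite /complexity fineK // delta_built // fin_numElt; apply/andP; split.
  apply: lt_le_trans (ltNyr 0) _; apply: le_ereal_inf_tmp => _ [ks _ <-].
  by rewrite lee_fin weight_ge0.
have [ks bF] := built_ex F genG.
apply: le_lt_trans (ltry (weight t ks)).
by apply: ereal_inf_lbound; exists ks.
Qed.

Lemma complexity_ge F x : ~ is_zero F ->
  (forall ks, built G ks F -> x <= weight t ks) -> x <= complexity F.
Proof.
move=> F0 xF; rewrite -lee_fin -deltaE delta_built //.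
by apply: le_ereal_inf_tmp => _ [ks bF <-]; rewrite lee_fin xF.
Qed.

Lemma complexity_ge0 F : 0 <= complexity F.
Proof.
have [F0|F0] := pselect (is_zero F); first by rewrite complexity_zero.
by apply: complexity_ge => // ks _; apply: weight_ge0.
Qed.

Lemma complexity_le F ks : built G ks F -> complexity F <= weight t ks.
Proof.
move=> bF; have [F0|F0] := pselect (is_zero F).
  by rewrite complexity_zero ?weight_ge0.
by rewrite -lee_fin -deltaE delta_built //; apply: ereal_inf_lbound; exists ks.
Qed.

(** Passes a scaled bound to the infimum. For [c = 0] one cannot divide, and one list that builds
    [F] gives [x <= 0]. *)
Lemma complexity_scale F x c : ~ is_zero F -> 0 <= c ->
  (forall ks, built G ks F -> x <= c * weight t ks) -> x <= c * complexity F.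
Proof.
move=> F0; rewrite le_eqVlt => /predU1P[<-|c0] h.
  by have [ks /h] := built_ex F genG; rewrite !mul0r.
rewrite -ler_pdivrMl //; apply: complexity_ge => // ks /h.
by rewrite ler_pdivrMl.
Qed.

Variable Phi : functor D D.
Hypothesis exPhi : exact_functor Phi.

Lemma complexity_fpow N E :
  complexity (fpow Phi N E) <= complexity (fpow Phi N G) * complexity E.
Proof.
have [NE0|NE0] := pselect (is_zero (fpow Phi N E)).
  by rewrite complexity_zero // mulr_ge0 ?complexity_ge0.
have E0 : ~ is_zero E by move=> /(fpow_zero exPhi N).
have NG0 : ~ is_zero (fpow Phi N G).
  move=> NG0; apply: NE0; have [ks /(fpow_built exPhi N) bE] := built_ex E genG.
  exact: built_is_zero NG0 bE.
apply: complexity_scale; rewrite ?complexity_ge0 // => ls bE.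
rewrite mulrC; apply: complexity_scale; rewrite ?weight_ge0 // => ks bG.
rewrite mulrC -weight_allpairs; apply: complexity_le.
exact: built_comp bG (fpow_built exPhi N bE).
Qed.

Hypothesis Phi_neq0 : forall N : nat, (0 < N)%N ->
  forall (Z : D) (Z0 : is_zero Z), ~ fisom (fpow Phi N) (fzero D Z0).

(** A power that kills [G] kills everything built from [G], hence all of [D], and is a zero functor.
    The power 0 is reduced to the power 1. *)
Lemma fpow_generator_nonzero N : ~ is_zero (fpow Phi N G).
Proof.
suff NG0 n : ~ is_zero (fpow Phi n.+1 G).
  by case: N => [/(fpow_zero exPhi 1)/NG0|n /NG0].
move=> G0; case: (@Phi_neq0 n.+1 isT _ G0).
have all0 X : is_zero (fpow Phi n.+1 X).
  have [ks /(fpow_built exPhi n.+1) bX] := built_ex X genG.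
  exact: built_is_zero G0 bX.
exists (fun X => 0); split=> [X Y f|X]; first by rewrite comp0l comp0r.
by exists 0; split; symmetry; rewrite comp0l; apply/is_zeroP.
Qed.

Section Comparison.
Variables (d : D -> R) (C c : R).
Hypothesis d_gt0 : forall F, ~ is_zero F -> 0 < d F.
Hypothesis d_zero : forall F, is_zero F -> d F = 0.
Hypothesis complexity_le_d : forall F, complexity F <= C * d F.
Hypothesis d_le_complexity : forall F, d F <= c * complexity F.

Let cn N := complexity (fpow Phi N G).

Lemma cn_gt0 N : 0 < cn N.
Proof.
have dN := d_gt0 (@fpow_generator_nonzero N).
have := lt_le_trans dN (d_le_complexity _); rewrite -/(cn N) => h.
rewrite lt_neqAle complexity_ge0 andbT eq_sym; apply/eqP => cn0.
by move: h; rewrite cn0 mulr0 ltxx.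
Qed.

Local Open Scope ereal_scope.

Lemma entropy_seqE : entropy_seq G Phi t = fun N => (N%:R^-1 * ln (cn N))%:E.
Proof.
apply/funext => N; rewrite /entropy_seq /growth deltaE lne_EFin ?cn_gt0 //.
Qed.

Lemma cn_subadditive m n : (ln (cn (m + n)) <= ln (cn m) + ln (cn n))%R.
Proof.
rewrite -lnM ?posrE ?cn_gt0 // ler_ln ?posrE ?mulr_gt0 ?cn_gt0 //.
by rewrite /cn fpowD; apply: complexity_fpow.
Qed.

Lemma entropy_comparison : cvgn (entropy_seq G Phi t) /\
  cat_entropy G Phi t = ereal_sup
    [set limn_esup (growth (fun N => (d (fpow Phi N E))%:E)) | E in [set: D]].
Proof.
have cvl := fekete cn_subadditive; rewrite -entropy_seqE in cvl.
set l := ereal_inf _ in cvl.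
split; first by apply/cvg_ex; exists l.
have -> : cat_entropy G Phi t = l by apply/cvg_lim.
apply/eqP; rewrite eq_le; apply/andP; split; last first.
  apply: ge_ereal_sup => _ [E _ <-].
  rewrite -(cvg_limn_esup (cvg_add_inv_mul (ln (c * complexity E)) cvl)).
  apply: limn_esup_le; exists 1%N => // N /= N0; rewrite entropy_seqE.
  have Ni : (0 < N%:R^-1 :> R)%R by rewrite invr_gt0 ltr0n.
  (* Where [Phi^N E] is zero, the left side is -oo. *)
  rewrite /growth; have [NE0|/d_gt0 dN] := pselect (is_zero (fpow Phi N E)).
    by rewrite d_zero // le0_lneNy // gt0_muleNy ?leNye.
  rewrite lne_EFin // -EFinM -EFinD lee_fin -mulrDr ler_pM2l //.
  have h : (d (fpow Phi N E) <= cn N * (c * complexity E))%R.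
    have c0 : (0 <= c)%R.
      have := lt_le_trans dN (d_le_complexity _).
      by apply: contraLR; rewrite -ltNge -leNgt => /ltW c0; rewrite mulr_le0_ge0 ?complexity_ge0.
    apply: le_trans (d_le_complexity _) _; rewrite mulrCA ler_wpM2l //.
    exact: complexity_fpow.
  have k0 : (0 < c * complexity E)%R.
    by have := lt_le_trans dN h; rewrite pmulr_rgt0 // cn_gt0.
  have hp := mulr_gt0 (cn_gt0 N) k0.
  by rewrite -lnM ?posrE ?cn_gt0 // ler_ln ?posrE.
apply: le_ereal_sup_tmp.
exists (limn_esup (growth (fun N => (d (fpow Phi N G))%:E))); first by exists G.
rewrite -(cvg_limn_esup (cvg_add_inv_mul (- ln C) cvl)).
apply: limn_esup_le; exists 1%N => // N /= N0; rewrite entropy_seqE.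
have Ni : (0 < N%:R^-1 :> R)%R by rewrite invr_gt0 ltr0n.
have dN := d_gt0 (@fpow_generator_nonzero N).
rewrite /growth lne_EFin // -EFinM -EFinD lee_fin -mulrDr ler_pM2l //.
have h := complexity_le_d (fpow Phi N G).
have C0 : (0 < C)%R.
  by have := lt_le_trans (cn_gt0 N) h; rewrite pmulr_lgt0.
have hp := mulr_gt0 C0 dN.
by rewrite lerBlDl -lnM ?posrE // ler_ln ?posrE ?cn_gt0.
Qed.

End Comparison.
End Complexity.

Theorem theorem1p3 (R : realType) (K : closedFieldType) (D : tricat K)
    (idemD : idempotent_complete D)
    (Phi : functor D D) (exPhi : exact_functor Phi)
    (Phi_neq0 : forall N : nat, (0 < N)%N ->
       forall (Z : D) (Z0 : is_zero Z), ~ fisom (fpow Phi N) (fzero D Z0))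
    (t : R) (G : D) (genG : split_generator G) :
  (forall a : t_structure D, t_bounded a -> finite_length_cat (heart a) ->
     cvgn (entropy_seq G Phi t) /\
     cat_entropy G Phi t = hat_entropy a Phi t) /\
  (forall b : cot_structure D, cot_bounded b ->
     finite_krull_schmidt (coheart b) ->
     cvgn (entropy_seq G Phi t) /\
     cat_entropy G Phi t = check_entropy b Phi t).
Proof.
have transfer (d : D -> R) : (forall F, ~ is_zero F -> 0 < d F) ->
    (forall F, is_zero F -> d F = 0) ->
    (exists2 C : R, 0 <= C & forall F,
      exists2 ls, built G ls F & weight t ls <= C * d F) ->
    (forall ls F, built G ls F -> d F <= d G * weight t ls) ->
    cvgn (entropy_seq G Phi t) /\ cat_entropy G Phi t = ereal_sup
      [set limn_esup (growth (fun N => (d (fpow Phi N E))%:E)) | E in [set: D]].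
  move=> d_gt0 d_zero [C C0 bC] dle.
  (* The bound of [d F] by a multiple of the complexity has constant [d G]: it is the multiplicative
     estimate, passed to the infimum over [ls]. *)
  apply: (entropy_comparison genG exPhi Phi_neq0 (C := C) (c := d G)) => // F.
    have [ls bF lsw] := bC F; apply: le_trans lsw; exact: complexity_le.
  have [F0|F0] := pselect (is_zero F).
    by rewrite d_zero // complexity_zero // mulr0.
  apply: complexity_scale => //; last by move=> ks; apply: dle.
  by have [/d_zero->//|/d_gt0/ltW] := pselect (is_zero G).
split=> [a bnd fin|b bnd fin].
  apply: transfer.
  - by move=> F; apply: hat_delta_gt0.
  - by move=> F; apply: hat_delta_zero.
  - exact: built_hat_delta.
  - by move=> ls F; apply: hat_delta_built.
have -> : check_entropy b Phi t = ereal_sup [set limn_esup (growth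
    (fun N => (weight t (min_list b (fpow Phi N E)))%:E)) | E in [set: D]].
  rewrite /check_entropy; congr (ereal_sup (image _ _)); apply/funext => E.
  by congr (limn_esup (growth _)); apply/funext => N; rewrite check_deltaE.
apply: (transfer (fun F => weight t (min_list b F))).
- by move=> F; apply: min_list_gt0.
- by move=> F; apply: min_list_zero.
- exact: built_min_list.
- by move=> ls F; apply: min_list_built.
Qed.
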